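(* Let $I\subset(0,+\infty)$ be an interval and let $\Phi_\rho:E\to\mathbb{R}$, $\rho\in I$, be a family of $C^2$ functionals of the form $$\Phi_\rho(u)=A(u)-\rho B(u),\qquad \rho\in I,$$ where $B(u)\ge 0$ for every $u\in E$, and $$\text{either } A(u)\to+\infty \text{ or } B(u)\to+\infty \quad\text{as } u\in E \text{ and } \|u\|\to+\infty.$$ Suppose moreover that, for some $\alpha\in(0,1]$, $\Phi_\rho'$ and $\Phi_\rho''$ are $\alpha$-Hölder continuous on bounded sets for every $\rho \in I$. Finally, suppose that there exist $w_1,w_2\in S_\mu$ (independent of $\rho$) such that, setting $$\Gamma=\{\gamma\in C([0,1],S_\mu)\,:\,\gamma(0)=w_1,\ \gamma(1)=w_2\},$$ we have $$c_\rho:=\inf_{\gamma\in\Gamma}\ \max_{t\in[0,1]}\Phi_\rho(\gamma(t))>\max\{\Phi_\rho(w_1),\Phi_\rho(w_2)\},\qquad \rho\in I.$$ Then, for almost every $\rho\in I$, there exist sequences $\{u_n\}\subset S_\mu$ and $\zeta_n\to0^+$ such that, as $n\to+\infty$: (i) $\Phi_\rho(u_n)\to c_\rho$; (ii) $\|\Phi_\rho'|_{S_\mu}(u_n)\|_*\to0$; (iii) $\{u_n\}$ is bounded in $E$; (iv) $\tilde m_{\zeta_n}(u_n)\le 1$, where $\tilde m_{\zeta_n}$ is the approximate Morse index associated with $\Phi_\rho$.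
   Context: Setting. $(E,\langle\cdot,\cdot\rangle)$ and $(H,(\cdot,\cdot))$ are infinite-dimensional real Hilbert spaces with continuous injections $E\hookrightarrow H\hookrightarrow E'$; the injection $E\hookrightarrow H$ has norm at most $1$ and $E$ is identified with its image in $H$. Write $\|u\|^2=\langle u,u\rangle$ and $|u|^2=(u,u)$ for $u\in E$. For a fixed $\mu\in(0,+\infty)$, $S_\mu=\{u\in E: |u|^2=\mu\}$, a codimension-one submanifold of $E$ with tangent space $T_uS_\mu=\{v\in E:(u,v)=0\}$ at $u\in S_\mu$; $S_\mu$ carries the topology induced from $E$. $\|\cdot\|_*$ and $\|\cdot\|_{**}$ denote the operator norms of $\mathcal{L}(E,\mathbb{R})$ and $\mathcal{L}(E,\mathcal{L}(E,\mathbb{R}))$. For $u\in S_\mu$, $\phi'|_{S_\mu}(u)$ denotes the differential at $u$ of the restriction of $\phi$ to $S_\mu$, a linear form on $T_uS_\mu$, and $\|\phi'|_{S_\mu}(u)\|_*$ is its dual norm with respect to the norm $\|\cdot\|$ on $T_uS_\mu$ inherited from $E$. For a $C^2$ functional $\phi$ on $E$ and $\alpha\in(0,1]$, $\phi'$ and $\phi''$ are $\alpha$-Hölder continuous on bounded sets if for any $R>0$ there is $M=M(R)>0$ such that for all $u_1,u_2\in B(0,R)$ (ball of $E$): $\|\phi'(u_1)-\phi'(u_2)\|_*\le M\|u_1-u_2\|^\alpha$ and $\|\phi''(u_1)-\phi''(u_2)\|_{**}\le M\|u_1-u_2\|^\alpha$. For a $C^2$ functional $\phi$ on $E$ and $u\in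 E\setminus\{0\}$, $D^2\phi(u)$ is the continuous bilinear form $D^2\phi(u)=\phi''(u)-\frac{\phi'(u)\cdot u}{|u|^2}(\cdot,\cdot)$. For $u\in S_\mu$ and $\theta>0$ the approximate Morse index (associated with $\phi$) is $$\tilde m_\theta(u)=\sup\{\dim L : L \text{ is a subspace of } T_uS_\mu \text{ such that } D^2\phi(u)[\varphi,\varphi]<-\theta\|\varphi\|^2 \ \forall\varphi\in L\setminus\{0\}\}.$$ *)

(* Defs.v *)
From HB Require Import structures.
From mathcomp Require Import all_boot all_order all_algebra.
From mathcomp Require Import all_classical all_reals all_analysis.
Set Implicit Arguments.
Unset Strict Implicit.
Unset Printing Implicit Defensive.
Import Order.TTheory GRing.Theory Num.Theory.
Import numFieldNormedType.Exports.
Local Open Scope classical_set_scope.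
Local Open Scope ring_scope.

HB.mixin Record NormedModule_isHilbert (R : realType) H
    & CompleteNormedModule R H := {
  inner : {dot H for idfun} ;
  norm_inner : forall u : H, `|u| ^+ 2 = inner u u
}.

#[short(type="hilbertType")]
HB.structure Definition Hilbert (R : realType) :=
  {H of CompleteNormedModule R H & NormedModule_isHilbert R H}.

Section Dimension.
Context {R : realType} {V : lmodType R}.

Definition linear_subspace (L : set V) :=
  L 0 /\ forall (a : R) u v, L u -> L v -> L (a *: u + v).

Definition lin_indep n (e : 'I_n -> V) :=
  forall a : 'I_n -> R, \sum_(i < n) a i *: e i = 0 -> forall i, a i = 0.

(* The dimension of the linear subspace L, all infinite cardinals being
   identified with +oo. *)
Definition edim (L : set V) : \bar R :=
  ereal_sup [set n%:R%:E | n in [set n |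
    exists2 e : 'I_n -> V, lin_indep e & forall i, L (e i)]].

End Dimension.

Definition infinite_dim {R : realType} (V : lmodType R) :=
  edim [set: V] = +oo%E.

Section BoundedLinear.
Context {R : realType} {V W : normedModType R}.

(* The norm of the restriction of f to T, for f linear and bounded and T a
   linear subspace. *)
Definition norm_on (T : set V) (f : V -> W) : R :=
  sup [set `|f v| | v in T `&` [set v | `|v| <= 1]].

Definition bounded_linear_pred : {pred V -> W} :=
  fun f => `[< linear f /\ continuous f >].

Lemma bounded_linear_closed : GRing.submod_closed bounded_linear_pred.
Proof.
split.
  apply/asboolP; split; first by move=> a x y; rewrite /= scaler0 addr0.
  exact: cst_continuous.
move=> a f g /asboolP[lf cf] /asboolP[lg cg]; apply/asboolP; split.
  move=> b x y; rewrite /= !fctE /= lf lg !scalerDr !scalerA [a * b]mulrC.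
  by rewrite !addrA; congr (_ + _); rewrite -!addrA; congr (_ + _); rewrite addrC.
by move=> x; have := cvgD (cvgZl_tmp (k := a) (cf x)) (cg x); apply.
Qed.

HB.instance Definition _ :=
  GRing.isSubmodClosed.Build R (V -> W) bounded_linear_pred
    bounded_linear_closed.

Record bounded_linear : Type := BoundedLinear {
  bounded_linear_fun :> V -> W ;
  _ : bounded_linear_fun \in bounded_linear_pred
}.

HB.instance Definition _ := [isSub for bounded_linear_fun].
HB.instance Definition _ := [Choice of bounded_linear by <:].
HB.instance Definition _ := [SubChoice_isSubLmodule of bounded_linear by <:].

Lemma bounded_linear_linear (f : bounded_linear) : linear f.
Proof. by case: f => f /= /asboolP[]. Qed.

Lemma bounded_linear_cts (f : bounded_linear) : continuous f.
Proof. by case: f => f /= /asboolP[]. Qed.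

HB.instance Definition _ (f : bounded_linear) :=
  GRing.isLinear.Build R V W *:%R f (@bounded_linear_linear f).

Definition op_norm (f : bounded_linear) : R := norm_on setT f.

Lemma op_norm_has_sup (f : bounded_linear) :
  has_sup [set `|f v| | v in setT `&` [set v : V | `|v| <= 1]].
Proof.
split; first by exists `|f 0|, 0 => //; split=> //=; rewrite normr0.
have /linear_bounded_continuous/bounded_funP/(_ 1)[M fM] :=
  @bounded_linear_cts f.
by exists M => _ [v [_ v1] <-]; exact: fM.
Qed.

Lemma op_normP (f : bounded_linear) v : `|v| <= 1 -> `|f v| <= op_norm f.
Proof.
by move=> v1; apply: (sup_upper_bound (op_norm_has_sup f)); exists v.
Qed.

Lemma op_norm_le (f : bounded_linear) M :
  (forall v, `|v| <= 1 -> `|f v| <= M) -> op_norm f <= M.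
Proof.
move=> fM; apply: ge_sup; first by case: (op_norm_has_sup f).
by move=> _ [v [_ v1] <-]; exact: fM.
Qed.

Lemma op_norm_ge0 (f : bounded_linear) : 0 <= op_norm f.
Proof. by apply: le_trans (op_normP f (v := 0) _); rewrite ?normr0. Qed.

Lemma op_normD (f g : bounded_linear) :
  op_norm (f + g) <= op_norm f + op_norm g.
Proof.
apply: op_norm_le => v v1; apply: le_trans (ler_normD _ _) _.
by apply: lerD; exact: op_normP.
Qed.

Lemma op_normZ_le (a : R) (f : bounded_linear) :
  op_norm (a *: f) <= `|a| * op_norm f.
Proof.
apply: op_norm_le => v v1; rewrite /= normrZ ler_wpM2l//; exact: op_normP.
Qed.

Lemma op_normZ (a : R) (f : bounded_linear) :
  op_norm (a *: f) = `|a| * op_norm f.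
Proof.
apply/le_anti; rewrite op_normZ_le/=.
have [->|a0] := eqVneq a 0; first by rewrite normr0 mul0r op_norm_ge0.
have := op_normZ_le a^-1 (a *: f).
by rewrite scalerA mulVf// scale1r normfV ler_pdivlMl ?normr_gt0.
Qed.

Lemma op_norm_eq0 (f : bounded_linear) : op_norm f = 0 -> f = 0.
Proof.
move=> f0; apply/val_inj/funext => v /=.
have [->|v0] := eqVneq v 0; first by rewrite linear0.
have : `|f (`|v|^-1 *: v)| <= 0.
  rewrite -f0; apply: op_normP.
  by rewrite normrZ normfV normr_id mulVf ?normr_eq0.
rewrite normr_le0 linearZ/= scaler_eq0 invr_eq0 normr_eq0 (negbTE v0)/=.
by move/eqP.
Qed.

HB.instance Definition _ := Lmodule_isNormed.Build R bounded_linear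
  op_normD op_normZ op_norm_eq0.

End BoundedLinear.
Arguments bounded_linear {R} V W.

Notation "''L' ( V , W )" := (bounded_linear V W) : type_scope.

Section Derivatives.
Context {R : realType} {V W : normedModType R}.

(* The differential 'd f u is continuous, hence belongs to 'L(V, W), as soon as
   f is differentiable at u. *)
Definition frechet (f : V -> W) (u : V) : 'L(V, W) :=
  insubd (0 : 'L(V, W)) ('d f u : V -> W).

Lemma frechetE (f : V -> W) (u : V) :
  differentiable f u -> frechet f u = 'd f u :> (V -> W).
Proof.
move=> df; rewrite /frechet insubdK//; apply/asboolP; split.
  by move=> a x y; rewrite linearP.
exact: diff_continuous.
Qed.

End Derivatives.

Definition C2 {R : realType} {V W : normedModType R} (f : V -> W) :=
  [/\ forall u, differentiable f u,
      forall u, differentiable (frechet f) u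
    & continuous (frechet (frechet f))].

Definition holder_on_bounded {R : realType} {V W : normedModType R}
    (alpha : R) (f : V -> W) :=
  forall r : R, 0 < r -> exists2 M : R, 0 < M &
    forall u1 u2, ball 0 r u1 -> ball 0 r u2 ->
      `|f u1 - f u2| <= M * `|u1 - u2| `^ alpha.

Definition norm_coercive {R : realType} {V : normedModType R} (f : V -> R) :=
  forall M : R, exists r : R, forall u, r <= `|u| -> M <= f u.

Section Constrained.
Context {R : realType} {E H : hilbertType R}.

(* E is identified with its image under iota, and the embedding of H into E' is
   the transpose of iota once H is identified with its own dual; its continuity
   is automatic. *)
Definition hilbert_rigging (iota : {linear E -> H}) :=
  [/\ injective iota,
      forall u, `|iota u| <= `|u|
    & injective (fun (h : H) (u : E) => inner h (iota u))].

Variable iota : {linear E -> H}.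

Definition sphere (mu : R) : set E := [set u | `|iota u| ^+ 2 = mu].

Definition tangent (u : E) : set E := [set v | inner (iota u) (iota v) = 0].

Definition paths (mu : R) (w1 w2 : E) : set (R -> E) :=
  [set gamma | [/\ {within `[0 : R, 1], continuous (gamma : R -> E)},
                   forall t, t \in `[0 : R, 1] -> sphere mu (gamma t),
                   gamma 0 = w1 & gamma 1 = w2]].

(* The supremum over [0, 1] is a maximum when phi is continuous. *)
Definition minimax (phi : E -> R) (mu : R) (w1 w2 : E) : R :=
  inf [set sup [set phi (gamma t) | t in `[0 : R, 1]] | gamma in paths mu w1 w2].

(* The differential at u of the restriction of phi to the sphere is the
   restriction of phi'(u) to the tangent space at u. *)
Definition constrained_norm (phi : E -> R) (u : E) : R :=
  norm_on (tangent u) (frechet (phi : E -> R^o) u).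

Definition D2 (phi : E -> R) (u v w : E) : R :=
  frechet (frechet (phi : E -> R^o)) u v w
  - frechet (phi : E -> R^o) u u / `|iota u| ^+ 2 * inner (iota v) (iota w).

Definition approx_morse_index (phi : E -> R) (theta : R) (u : E) : \bar R :=
  ereal_sup [set edim L | L in [set L |
    [/\ linear_subspace L, L `<=` tangent u &
        forall v, L v -> v != 0 -> D2 phi u v v < - theta * `|v| ^+ 2]]].

End Constrained.

(* Main.v *)
Require Import Defs.
From HB Require Import structures.
From mathcomp Require Import all_boot all_order all_algebra.
From mathcomp Require Import all_classical all_reals all_analysis.
From mathcomp Require Import ring lra.
Set Implicit Arguments.
Unset Strict Implicit.
Unset Printing Implicit Defensive.
Import Order.TTheory GRing.Theory Num.Theory.
Import numFieldNormedType.Exports.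
Local Open Scope classical_set_scope.
Local Open Scope ring_scope.

(** The level [c rho] of the minimax is nonincreasing in [rho], because [B] is
    nonnegative.  A monotone function has a bounded left difference quotient
    along some sequence at almost every point ([ae_left_slope_bounded]).  At such
    a [rho], a path that is almost optimal for a slightly smaller parameter [y] is
    almost optimal for [rho], and at its points of almost maximal height the
    quotient [(Phi y - Phi rho) / (rho - y) = B] is bounded; coercivity then
    bounds the norm of these points ([bounded_almost_optimal_paths]).  Thus, for
    arbitrarily small [eps], there are paths that stay below [c rho + eps] and
    whose part above [c rho - eps] lies in a fixed ball.

    Suppose that no point of that ball, slightly enlarged, near the level [c rho]
    has both constrained gradient at most [d] and approximate Morse index (for
    [d]) at most 1.  Then at each such point there is a tangent direction that
    lowers the functional: minus the gradient if the gradient is large, and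
    otherwise a vector of a plane on which the second variation is below
    [- d].  A path can be pushed down along these directions if they can be chosen
    continuously along it.  The path is cut into short pieces, a direction is
    chosen at each node one after the other, and consecutive directions are joined
    by segments.  In the quadratic model
    [m v = s * l v + s ^+ 2 / 2 * q v], where [l] and [q] are the first and second
    variations and [s] is the step,
      [m ((1 - tau) e + tau e') = (1 - tau)^2 m e + tau^2 m e' + tau (1 - tau) X],
    where [X = s l e + s l e' + s^2 b(e, e')] for the symmetric bilinear form [b] of [q].
    So the model stays negative on the segment as soon as [X <= 0].  Given [e], the
    requirements [l e' <= 0] and [X <= 0] follow from two linear inequalities on
    [e'], and these have a nonzero common solution in every plane: this is where
    index at least 2 is needed ([two_linear_inequalities], [descent_direction]).

    The error of the quadratic model is uniform on bounded parts of the sphere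
    ([taylor2_tangent]), and the step [s] is fixed before the path.  A cutoff that
    vanishes below the level [c rho - eps] leaves the remainder of the path alone,
    and the outcome is a path below [c rho - eps / 4] ([path_below_level]), which
    contradicts the definition of [c rho]. *)

(** * Left slopes of monotone functions *)

(** The lower left derivative of [- f] at [x] is not [+oo].  For monotone functions
    this holds almost everywhere by an elementary counting of grid cells, which
    replaces the differentiation theorem of Lebesgue. *)
Definition left_slope_bounded {R : realType} (D : set R) (f : R -> R) (x : R) :=
  exists M : R, forall eta, 0 < eta -> exists y,
    [/\ D y, x - eta < y, y < x & f y - f x <= M * (x - y)].

Section MonotoneSlopes.
Context {R : realType}.
Local Notation mu := (@lebesgue_measure R).

Section Grid.
Variables (a b : R) (f : R -> R).
Hypothesis ab : a < b.
Hypothesis f_ninc : forall x y, a <= x -> x <= y -> y <= b -> f y <= f x.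

Let mesh n : R := (b - a) / n.+1%:R.
Let node n k : R := a + k%:R * mesh n.
(* A point [x] of the cell from node [k.+1] to node [k.+2] is compared with node
   [k], which is at distance between one and two meshes on its left: the drop of
   [f] over both cells bounds the drop from node [k] to [x]. *)
Let steep K n k := f (node n k) - f (node n k.+2) > K * mesh n.
Let cell K n k := if steep K n k then `[node n k.+1, node n k.+2[%classic
  else set0.
Let steep_set K n := \big[setU/set0]_(k < n) cell K n k.

Let mesh_gt0 n : 0 < mesh n.
Proof. by rewrite divr_gt0 ?subr_gt0 ?ltr0n. Qed.

Let nodeS n k : node n k.+1 = node n k + mesh n.
Proof. by rewrite /node -natr1 mulrDl mul1r addrA. Qed.

Let node_ge n k : a <= node n k.
Proof. by rewrite lerDl mulr_ge0// ltW. Qed.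

Let node_le n k : (k <= n.+1)%N -> node n k <= b.
Proof.
move=> kn; rewrite -lerBrDl /node/mesh mulrCA ger_pMr ?subr_gt0//.
by rewrite ler_pdivrMr ?ltr0n// mul1r ler_nat.
Qed.

Let measurable_cell K n k : measurable (cell K n k).
Proof. by rewrite /cell; case: ifPn. Qed.

Let measurable_steep_set K n : measurable (steep_set K n).
Proof. exact: bigsetU_measurable. Qed.

Let mu_cell K n k : 0 < K -> (k < n)%N ->
  (mu (cell K n k) <= ((f (node n k) - f (node n k.+2)) / K)%:E)%E.
Proof.
move=> K0 kn; rewrite /cell /steep; case: ifPn => h.
  rewrite lebesgue_measure_itv/= lte_fin (nodeS n k.+1) ltrDl mesh_gt0.
  rewrite -EFinD (_ : _ - _ = mesh n); last by rewrite addrAC subrr add0r.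
  by rewrite lee_fin ler_pdivlMr// mulrC -nodeS; apply: ltW.
rewrite measure0 lee_fin divr_ge0 ?(ltW K0)// subr_ge0.
apply: f_ninc => //; last exact: node_le.
by rewrite !nodeS -addrA lerDl addr_ge0// ltW.
Qed.

(** The drops over two consecutive cells add up to at most twice the total drop,
    so the cells where the drop exceeds [K] times the mesh have total length
    [O(1 / K)], whatever the mesh. *)
Let mu_steep_set K n : 0 < K -> (mu (steep_set K n) <= (2 * (f a - f b) / K)%:E)%E.
Proof.
move=> K0; rewrite /steep_set.
apply: le_trans (@Boole_inequality _ _ _ mu (cell K n) n _) _.
  by move=> k _; exact: measurable_cell.
apply: (@le_trans _ _
   (\sum_(k < n) (((f (node n k) - f (node n k.+2)) / K)%:E))%E).
  by apply: lee_sum => k _; apply: mu_cell.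
rewrite sumEFin lee_fin -mulr_suml ler_wpM2r ?invr_ge0 ?(ltW K0)//.
have -> : forall m, \sum_(k < m) (f (node n k) - f (node n k.+2)) =
    f (node n 0) + f (node n 1) - f (node n m) - f (node n m.+1).
  elim=> [|m IH]; first by rewrite big_ord0; ring.
  by rewrite big_ord_recr/= IH; ring.
have n0 : node n 0 = a by rewrite /node mul0r addr0.
have h1 : f (node n 1) <= f a by apply: f_ninc => //; exact: node_le.
have h2 : f b <= f (node n n) by apply: f_ninc => //; exact: node_le.
have h3 : f b <= f (node n n.+1) by apply: f_ninc => //; exact: node_le.
by rewrite n0; lra.
Qed.

Let eventually_steep K :=
  \bigcup_m \bigcap_(n in [set n | (m <= n)%N]) steep_set K n.

Let measurable_eventually_steep K : measurable (eventually_steep K).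
Proof.
by apply: bigcupT_measurable => m; apply: bigcap_measurable => //; exists m => /=.
Qed.

Let mu_eventually_steep K : 0 < K ->
  (mu (eventually_steep K) <= (2 * (f a - f b) / K)%:E)%E.
Proof.
move=> K0; pose F m := \bigcap_(n in [set n | (m <= n)%N]) steep_set K n.
have mF m : measurable (F m) by apply: bigcap_measurable => //; exists m => /=.
have cF : mu (F m) @[m --> \oo] --> mu (\bigcup_m F m).
  apply: nondecreasing_cvg_mu => //; first exact: bigcupT_measurable.
  move=> m p mp; apply/subsetPset => x Fx n /= pn; apply: Fx => /=.
  exact: leq_trans pn.
have -> : mu (eventually_steep K) = limn (fun m => mu (F m)).
  by apply/esym/cvg_lim.
apply: lime_le; first by apply/cvg_ex; exists (mu (\bigcup_m F m)).
apply: nearW => m; apply: le_trans (mu_steep_set m K0).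
apply: (@le_measure _ _ _ mu (F m)); rewrite ?inE; first exact: mF.
  exact: measurable_steep_set.
by move=> x; apply; exact: leqnn.
Qed.

Let truncn_mesh n x : a <= x -> node n (Num.truncn ((x - a) / mesh n)) <= x /\
  x < node n (Num.truncn ((x - a) / mesh n)).+1.
Proof.
move=> ax; have /truncn_itv/andP[h1 h2] : 0 <= (x - a) / mesh n.
  by rewrite divr_ge0 ?subr_ge0// ltW.
rewrite /node -lerBrDl -ltrBlDl; split; first by rewrite -ler_pdivlMr.
by rewrite -ltr_pdivrMr.
Qed.

(** If [K] does not bound the left slopes at [x], then all sufficiently fine grids
    are steep at [x]. *)
Let unbounded_slope_steep K x : 0 < K -> a < x -> x < b ->
  ~ left_slope_bounded `[a, b] f x -> eventually_steep K x.
Proof.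
move=> K0 ax xb nb.
apply: contrapT => nF; apply: nb; exists K => eta eta0.
pose d := Num.min (x - a) (eta / 2).
have d0 : 0 < d by rewrite lt_min subr_gt0 ax divr_gt0.
have [m hm] : exists m : nat, forall n, (m <= n)%N -> mesh n < d.
  exists (Num.truncn ((b - a) / d)) => n mn.
  rewrite /mesh ltr_pdivrMr ?ltr0n// mulrC -ltr_pdivrMr//.
  have /truncn_itv/andP[_ h] : 0 <= (b - a) / d.
    by rewrite divr_ge0 ?subr_ge0// ltW.
  by apply: (lt_le_trans h); rewrite ler_nat ltnS.
have [n mn nS] : exists2 n, (m <= n)%N & ~ steep_set K n x.
  apply: contrapT => h; apply: nF; exists m => // n mn.
  by apply: contrapT => nS; apply: h; exists n.
have := hm n mn; rewrite lt_min => /andP[ha he].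
have [] := truncn_mesh n (ltW ax).
set k := Num.truncn _ => kx xk.
have k_gt0 : (0 < k)%N.
  rewrite lt0n; apply/negP => /eqP k0; move: xk.
  by rewrite k0 nodeS /node mul0r addr0; lra.
case: k k_gt0 kx xk => // k _ kx xk.
have kn : (k < n)%N.
  have : node n k.+1 < node n n.+1.
    apply: le_lt_trans kx (lt_le_trans xb _).
    by rewrite /node/mesh mulrC divfK ?pnatr_eq0//; lra.
  by rewrite /node ltrD2l ltr_pM2r// ltr_nat ltnS.
have nst : f (node n k) - f (node n k.+2) <= K * mesh n.
  rewrite leNgt; apply/negP => st; apply: nS.
  rewrite /steep_set -bigcup_mkord; exists k => //.
  by rewrite /cell /steep st /= in_itv/= kx xk.
have nk := nodeS n k; have nk1 := nodeS n k.+1; have m0 := mesh_gt0 n.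
exists (node n k); split.
- by rewrite /= in_itv/= node_ge node_le// ltnW// ltnW.
- lra.
- lra.
have fx : f (node n k.+2) <= f x.
  by apply: f_ninc; [exact: ltW|exact: ltW|exact: node_le].
have : K * mesh n <= K * (x - node n k) by rewrite ler_pM2l//; lra.
lra.
Qed.

(** The exceptional set lies in the set of points that are [K]-steep for all fine
    grids, whose measure is [O(1 / K)], for every [K]. *)
Lemma negligible_unbounded_slope_itv :
  mu.-negligible [set x | a < x < b /\ ~ left_slope_bounded `[a, b] f x].
Proof.
pose N := \bigcap_(K : nat) eventually_steep K.+1%:R.
have mN : measurable N by apply: bigcapT_measurable.
exists N; split => //; last first.
  by move=> x [/andP[ax xb] nb] K _; exact: unbounded_slope_steep.
apply/eqP; rewrite -measure_le0.
have V0 : 0 <= f a - f b by rewrite subr_ge0; apply: f_ninc => //; exact: ltW.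
have Nle K : (mu N <= (2 * (f a - f b) / K.+1%:R)%:E)%E.
  apply: le_trans (mu_eventually_steep _); last by rewrite ltr0n.
  apply: (@le_measure _ _ _ mu); rewrite ?inE; first exact: mN.
    exact: measurable_eventually_steep.
  by move=> x; apply.
apply/lee_addgt0Pr => e e0; rewrite add0e.
have := Nle (Num.truncn (2 * (f a - f b) / e)) => /le_trans; apply.
rewrite lee_fin ler_pdivrMr ?ltr0n// [e * _]mulrC -ler_pdivrMr//.
have /truncn_itv/andP[_ h] : 0 <= (2 * (f a - f b) / e).
  by rewrite divr_ge0 ?mulr_ge0// ltW.
exact: ltW.
Qed.

End Grid.

(** Applied to both strict orders, this discards the end points of an interval,
    which are in no interval with rational end points inside it. *)
Lemma negligible_extremal (I : set R) (r : rel R) :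
  (forall x y, x != y -> r x y || r y x) ->
  mu.-negligible [set x | I x /\ ~ exists2 y, I y & r x y].
Proof.
move=> rT; have [|/set0P[z [Iz nz]]] :=
  eqVneq [set x | I x /\ ~ exists2 y, I y & r x y] set0.
  by move=> ->; exact: negligible_set0.
exists [set z]; split => //; first exact: lebesgue_measure_set1.
move=> x [Ix nx] /=; apply/eqP/negPn/negP => /rT/orP[h|h].
  by apply: nx; exists z.
by apply: nz; exists x.
Qed.

Lemma ae_left_slope_bounded (I : set R) (f : R -> R) : is_interval I ->
  (forall x y, I x -> I y -> x <= y -> f y <= f x) ->
  {ae mu, forall x, I x -> left_slope_bounded I f x}.
Proof.
move=> itvI fI.
pose Q (p : rat * rat) : set R := [set x | [/\ I (ratr p.1), I (ratr p.2),
  ratr p.1 < x < ratr p.2 &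
   ~ left_slope_bounded `[ratr p.1, ratr p.2] f x]].
have Q0 p : mu.-negligible (Q p).
  have [[h1 [h2 h3]]|np] := pselect ((I (ratr p.1)) /\ I (ratr p.2) /\
     ratr p.1 < ratr p.2 :> R).
    apply: negligibleS (negligible_unbounded_slope_itv h3 (f := f) _).
      by move=> x [_ _ + ns] /=; split.
    move=> x y px xy yq; apply: fI => //; apply: (itvI _ _ h1 h2).
      by rewrite px (le_trans xy).
    by rewrite yq (le_trans px).
  apply: negligibleS (negligible_set0 _) => x [h1 h2 /andP[h3 h4] _].
  by apply: np; do 2?split => //; exact: lt_trans h4.
pose F n := if unpickle n is Some p then Q p else set0.
have F0 : mu.-negligible (\bigcup_n F n).
  apply: negligible_bigcup => n; rewrite /F.
  by case: unpickle => // *; exact: negligible_set0.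
have L0 := @negligible_extremal I (fun x y => x < y)
  (fun x y xy => lt_total xy).
have U0 := @negligible_extremal I (fun x y => y < x)
  (fun x y xy => etrans (orbC _ _) (lt_total xy)).
apply: negligibleS (negligibleU F0 (negligibleU L0 U0)) => x /= /not_implyP[Ix ns].
have [[y Iy xy]|] := pselect (exists2 y, I y & x < y); last by right; left.
have [[z Iz zx]|] := pselect (exists2 y, I y & y < x); last by right; right.
left.
have [q qxy] := rat_in_itvoo xy; have [p pzx] := rat_in_itvoo zx.
move: qxy pzx; rewrite !inE/= => /andP[q1 q2] /andP[p1 p2].
suff Qx : Q (p, q) x.
  have : F (pickle (p, q)) x by rewrite /F pickleK.
  by move: (pickle _) => n Fx; exists n.
split => /=.
- by apply: (itvI _ _ Iz Ix); rewrite !ltW.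
- by apply: (itvI _ _ Ix Iy); rewrite !ltW.
- by apply/andP.
- move=> [M hM]; apply: ns; exists M => eta /hM[t [+ h1 h2 h3]].
  rewrite /= in_itv/= => /andP[t1 t2]; exists t; split => //.
  by apply: (itvI _ _ Iz Ix); rewrite (ltW h2) (le_trans _ t1)// ltW.
Qed.

End MonotoneSlopes.

(** * Bounded operators and the second-order Taylor formula *)

Section OperatorBounds.
Context {R : realType} {V W : normedModType R}.

Lemma norm_on_ge0 (T : set V) (f : V -> W) : T 0 -> 0 <= norm_on T f.
Proof.
move=> T0; rewrite /norm_on.
set S := [set _ | _ in _]; have [hs|/sup_out ->//] := pselect (has_sup S).
apply: le_trans (normr_ge0 (f 0)) _; apply: (sup_upper_bound hs).
by exists 0 => //; split => //=; rewrite normr0.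
Qed.

Lemma norm_on_gt (T : set V) (f : V -> W) d : 0 < d -> d < norm_on T f ->
  exists v, [/\ T v, `|v| <= 1 & d < `|f v|].
Proof.
move=> d0 dn; apply: contrapT => h; move: dn; rewrite ltNge => /negP; apply.
rewrite /norm_on; set S := [set _ | _ in _].
have [->|/set0P S0] := eqVneq S set0; first by rewrite sup0 ltW.
apply: ge_sup => // _ [v [Tv v1] <-].
by rewrite leNgt; apply/negP => fv; apply: h; exists v.
Qed.

Lemma op_norm_apply (f : 'L(V, W)) v : `|f v| <= `|f| * `|v|.
Proof.
have [->|v0] := eqVneq v 0; first by rewrite linear0 !normr0 mulr0.
have vp : 0 < `|v| by rewrite normr_gt0.
have := @op_normP _ _ _ f (`|v|^-1 *: v).
rewrite normrZ normfV normr_id mulVf ?gt_eqF// => /(_ (lexx _)).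
by rewrite linearZ/= normrZ normfV normr_id mulrC ler_pdivrMr.
Qed.

Lemma bounded_linearD (f g : 'L(V, W)) v : (f + g) v = f v + g v.
Proof. by []. Qed.

Lemma bounded_linearB (f g : 'L(V, W)) v : (f - g) v = f v - g v.
Proof. by []. Qed.

Lemma bounded_linearZ a (f : 'L(V, W)) v : (a *: f) v = a *: f v.
Proof. by []. Qed.

Lemma bounded_linear_apply_sub (f g : 'L(V, W)) x y :
  f x - g y = (f - g) x + g (x - y).
Proof. by rewrite bounded_linearB linearB addrA subrK. Qed.

End OperatorBounds.

Section BilinearOperators.
Context {R : realType} {V W : normedModType R}.

Lemma bilinear_operatorB (F G : 'L(V, 'L(V, W))) v w :
  (F - G) v w = F v w - G v w.
Proof. by rewrite bounded_linearB. Qed.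

Lemma op_norm_apply2 (F : 'L(V, 'L(V, W))) v w : `|F v w| <= `|F| * `|v| * `|w|.
Proof.
by rewrite (le_trans (op_norm_apply _ _))// ler_wpM2r// op_norm_apply.
Qed.

Lemma bilinear_apply_sub (F G : 'L(V, 'L(V, W))) x y x' y' :
  F x y - G x' y' = (F - G) x y + G (x - x') y + G x' (y - y').
Proof.
by rewrite bilinear_operatorB [G (x - x')]linearB bounded_linearB
  [G x' (y - y')]linearB !addrA !subrK.
Qed.

End BilinearOperators.

Section UniformContinuity.
Context {R : realType} {V W : normedModType R}.

Definition unif_cont_on_bounded (f : V -> W) := forall r e : R, 0 < e ->
  exists2 d, 0 < d & forall u v, `|u| <= r -> `|v| <= r -> `|u - v| <= d ->
    `|f u - f v| <= e.

(** What the argument takes from the Hoelder condition is uniform continuity and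
    boundedness on bounded sets. *)
Lemma holder_unif_cont (alpha : R) (f : V -> W) : 0 < alpha ->
  holder_on_bounded alpha f -> unif_cont_on_bounded f.
Proof.
move=> a0 hf r e e0.
have r1 : 0 < `|r| + 1 by rewrite ltr_pwDr.
have [M M0 hM] := hf _ r1.
exists ((e / M) `^ alpha^-1); first by rewrite powR_gt0// divr_gt0.
move=> u v ur vr uvd.
have inball w : `|w| <= r -> ball (0 : V) (`|r| + 1) w.
  move=> wr; rewrite -ball_normE /= sub0r normrN.
  by rewrite (le_lt_trans wr)// (le_lt_trans (ler_norm r))// ltrDl.
apply: (le_trans (hM u v (inball _ ur) (inball _ vr))).
rewrite mulrC -ler_pdivlMr//.
have := @ge0_ler_powR _ alpha (ltW a0) _ _ (normr_ge0 _) (powR_ge0 _ _) uvd.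
by rewrite -powRrM mulVf ?gt_eqF// powRr1 // ltW// divr_gt0.
Qed.

Definition bounded_on_bounded (f : V -> W) := forall r : R,
  exists2 K, 0 < K & forall u, `|u| <= r -> `|f u| <= K.

Lemma holder_bounded (alpha : R) (f : V -> W) : 0 < alpha ->
  holder_on_bounded alpha f -> bounded_on_bounded f.
Proof.
move=> a0 hf r; have r1 : 0 < `|r| + 1 by rewrite ltr_pwDr.
have [M M0 hM] := hf _ r1.
exists (`|f 0| + M * (`|r| + 1) `^ alpha).
  by rewrite ltr_wpDl// mulr_gt0// powR_gt0.
move=> u ur.
have ur1 : `|u| < `|r| + 1.
  by rewrite (le_lt_trans ur)// (le_lt_trans (ler_norm r))// ltrDl.
have := hM u 0; rewrite subr0.
rewrite -!ball_normE /= sub0r subrr normrN normr0 => /(_ ur1 r1) h.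
have p : `|u| `^ alpha <= (`|r| + 1) `^ alpha.
  apply: ge0_ler_powR; rewrite ?nnegrE//; exact: ltW.
rewrite -(subrK (f 0) (f u)) (le_trans (ler_normD _ _))// addrC lerD2l.
by rewrite (le_trans h)// ler_wpM2l// ltW.
Qed.

End UniformContinuity.

Definition unif_C2 {R : realType} {V : normedModType R} (phi : V -> R^o) :=
  [/\ forall u, differentiable phi u,
      forall u, differentiable (frechet phi) u,
      unif_cont_on_bounded (frechet phi) /\ bounded_on_bounded (frechet phi)
    & unif_cont_on_bounded (frechet (frechet phi)) /\
      bounded_on_bounded (frechet (frechet phi))].

Section Taylor.
Context {R : realType} {V : normedModType R}.

Lemma is_derive_line {W : normedModType R} (f : V -> W) (u h : V) (t : R) :
  differentiable f (u + t *: h) ->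
  is_derive t 1 (fun s : R => f (u + s *: h)) ('d f (u + t *: h) h).
Proof.
move=> df; have hd := @diff_derivable _ _ _ _ _ h df.
have E : (fun s : R => s^-1 *: (((fun s => f (u + s *: h)) \o shift t) (s *: 1) -
    f (u + t *: h))) =
  (fun s : R => s^-1 *: ((f \o shift (u + t *: h)) (s *: h) - f (u + t *: h))).
  apply/funext => s /=; congr (_ *: (f _ - _)).
  by rewrite scalerDl addrCA [s%:A]mulr1.
apply: DeriveDef; first by rewrite /derivable E.
by rewrite /derive E -deriveE.
Qed.

(** Evaluation at a fixed vector is a continuous linear map on operators. *)
Lemma is_derive_eval {W : normedModType R} (F : R -> 'L(V, W)) (h : V) (t : R)
    (dF : 'L(V, W)) :
  is_derive t 1 F dF -> is_derive t 1 (fun s => F s h) (dF h).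
Proof.
move=> [dFt dFE].
have ev (f : R -> 'L(V, W)) (l : 'L(V, W)) :
    f s @[s --> 0^'] --> l -> f s h @[s --> 0^'] --> l h.
  move=> fl; apply/cvgrPdist_le => e e0.
  have e' : 0 < e / (`|h| + 1) by rewrite divr_gt0// ltr_pwDr.
  move/cvgrPdist_le : fl => /(_ _ e'); apply: filterS => s hs.
  rewrite -bounded_linearB (le_trans (op_norm_apply _ _))//.
  rewrite (le_trans (ler_wpM2r _ hs))// mulrAC ler_pdivrMr ?ltr_pwDr//.
  by rewrite ler_pM2l// lerDl.
have FE : (fun s : R => s^-1 *: ((F \o shift t) (s *: 1) - F t)) s
    @[s --> 0^'] --> dF by rewrite -dFE.
have lim := ev _ _ FE.
apply: DeriveDef; first by apply/cvg_ex; exists (dF h).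
by apply/cvg_lim.
Qed.

(** Two applications of the mean value theorem: to [g] minus its Taylor polynomial
    at 0, and to the derivative of that difference. *)
Lemma taylor2_real (g g1 g2 : R -> R) (M : R) :
  (forall t : R, is_derive t (1 : R) g (g1 t)) ->
  (forall t : R, is_derive t (1 : R) g1 (g2 t)) ->
  (forall t, 0 < t -> t < 1 -> `|g2 t - g2 0| <= M) ->
  `|g 1 - g 0 - g1 0 - g2 0 / 2| <= M.
Proof.
move=> dg dg1 g2M.
pose k : R -> R := g - (cst (g 0) + g1 0 \*: id + (g2 0 / 2) \*: (id * id)).
pose k1 : R -> R := g1 - (cst (g1 0) + g2 0 \*: id).
have did (t : R) : is_derive t (1 : R) (id : R -> R) 1 := is_derive_id t 1.
have dk (t : R) : is_derive t (1 : R) k (k1 t).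
  have [h1 h2] := is_deriveB (dg t) (is_deriveD
    (is_deriveD (is_derive_cst (g 0) t 1) (is_deriveZ (g1 0) (did t)))
    (is_deriveZ (g2 0 / 2) (is_deriveM (did t) (did t)))).
  apply: DeriveDef; first exact: h1.
  rewrite [LHS]h2 /k1 !fctE /= /GRing.scale /=; lra.
have dk1 (t : R) : is_derive t (1 : R) k1 (g2 t - g2 0).
  have [h1 h2] := is_deriveB (dg1 t) (is_deriveD (is_derive_cst (g1 0) t 1)
    (is_deriveZ (g2 0) (did t))).
  apply: DeriveDef; first exact: h1.
  by rewrite [LHS]h2 /GRing.scale /=; ring.
have ck (f df : R -> R) : (forall t : R, is_derive t (1 : R) f (df t)) ->
    forall b : R, {within `[0, b], continuous f}.
  move=> fd b; apply: derivable_within_continuous => t _.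
  by have [] := fd t.
have [x + Ex] := MVT ltr01 (fun t _ => dk t) (ck _ _ dk 1).
rewrite in_itv/= => /andP[x0 x1].
have [y + Ey] := MVT x0 (fun t _ => dk1 t) (ck _ _ dk1 x).
rewrite in_itv/= => /andP[y0 yx].
have k0 : k 0 = 0 by rewrite /k !fctE /= /GRing.scale /=; ring.
have k10 : k1 0 = 0 by rewrite /k1 !fctE /= /GRing.scale /=; ring.
have -> : g 1 - g 0 - g1 0 - g2 0 / 2 = (g2 y - g2 0) * x.
  move: Ex; rewrite k0 !subr0 mulr1.
  move: Ey; rewrite k10 !subr0 => <- <-.
  by rewrite /k !fctE /= /GRing.scale /=; ring.
rewrite normrM (gtr0_norm x0) -[leRHS]mulr1.
apply: ler_pM => //; [exact: ltW| |exact: ltW].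
by apply: g2M => //; exact: lt_trans x1.
Qed.

Lemma taylor2 (phi : V -> R^o) (r sigma : R) : unif_C2 phi -> 0 < sigma ->
  exists2 d, 0 < d & forall u h, `|u| <= r -> `|h| <= d ->
    `|phi (u + h) - phi u - frechet phi u h - frechet (frechet phi) u h h / 2|
    <= sigma * `|h| ^+ 2.
Proof.
move=> [phi_diff dphi_diff _ [d2_uc _]] s0.
have [d d0 hd] := d2_uc (r + 1) _ s0.
exists (Num.min d 1); first by rewrite lt_min d0 ltr01.
move=> u h ur; rewrite le_min => /andP[h_d h1].
have d2_close (t : R) : 0 < t -> t < 1 ->
    `|frechet (frechet phi) (u + t *: h) - frechet (frechet phi) u| <= sigma.
  move=> t0 t1; have th : `|t *: h| <= `|h|.
    by rewrite normrZ (gtr0_norm t0) ler_piMl// ltW.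
  apply: hd.
  - exact: le_trans (ler_normD _ _) (lerD ur (le_trans th h1)).
  - by apply: le_trans ur _; rewrite lerDl.
  - by rewrite addrAC subrr add0r (le_trans th).
have d2_close_hh (t : R) : 0 < t -> t < 1 ->
    `|frechet (frechet phi) (u + t *: h) h h - frechet (frechet phi) u h h|
    <= sigma * `|h| ^+ 2.
  move=> t0 t1; rewrite -bilinear_operatorB.
  apply: le_trans (op_norm_apply2 _ _ _) _; rewrite expr2 mulrA.
  by apply: ler_wpM2r => //; apply: ler_wpM2r => //; exact: d2_close.
pose g (t : R) : R := phi (u + t *: h).
pose g1 (t : R) : R := frechet phi (u + t *: h) h.
pose g2 (t : R) : R := frechet (frechet phi) (u + t *: h) h h.
have dg (t : R) : is_derive t 1 g (g1 t).
  by rewrite /g1 frechetE//; exact: is_derive_line.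
have dg1 (t : R) : is_derive t 1 g1 (g2 t).
  rewrite /g2; apply: is_derive_eval; rewrite frechetE//.
  exact: is_derive_line.
have gE : phi (u + h) - phi u - frechet phi u h -
    frechet (frechet phi) u h h / 2 = g 1 - g 0 - g1 0 - g2 0 / 2.
  by rewrite /g /g1 /g2 !scale0r !addr0 scale1r.
rewrite gE; apply: (taylor2_real dg dg1) => t t0 t1.
by rewrite /g2 scale0r addr0; exact: d2_close_hh.
Qed.

End Taylor.

(** * The sphere and its tangent spaces *)

Section SphereGeometry.
Context {R : realType} {E H : hilbertType R}.
Variable iota : {linear E -> H}.
Hypothesis iota_le : forall u, `|iota u| <= `|u|.
Variable mu : R.
Hypothesis mu_gt0 : 0 < mu.

Definition hip (u v : E) : R := inner (iota u) (iota v).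

Lemma hipC u v : hip u v = hip v u.
Proof. by rewrite /hip hermC /= expr0 mul1r. Qed.

Lemma hipDr u v w : hip u (v + w) = hip u v + hip u w.
Proof. by rewrite /hip !linearD. Qed.

Lemma hipZr a u v : hip u (a *: v) = a * hip u v.
Proof. by rewrite /hip !linearZ. Qed.

Lemma hipDl u v w : hip (v + w) u = hip v u + hip w u.
Proof. by rewrite ![hip _ u]hipC hipDr. Qed.

Lemma hipZl a u v : hip (a *: v) u = a * hip v u.
Proof. by rewrite ![hip _ u]hipC hipZr. Qed.

Lemma hipBr u v w : hip u (v - w) = hip u v - hip u w.
Proof. by rewrite hipDr -scaleN1r hipZr mulN1r. Qed.

Lemma hipBl u v w : hip (v - w) u = hip v u - hip w u.
Proof. by rewrite ![hip _ u]hipC hipBr. Qed.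

Lemma hipxx u : hip u u = `|iota u| ^+ 2.
Proof. by rewrite norm_inner. Qed.

Lemma hip_le u v : `|hip u v| <= `|u| * `|v|.
Proof.
suff CS x y : hip x y <= `|iota x| * `|iota y|.
  have uv : `|iota u| * `|iota v| <= `|u| * `|v| by rewrite ler_pM.
  rewrite ler_norml (le_trans (CS u v) uv) andbT lerNl.
  have := CS (- u) v; rewrite -scaleN1r hipZl mulN1r => /le_trans; apply.
  by rewrite linearZ/= scaleN1r normrN.
have : hip (x + y) (x + y) <= (`|iota x| + `|iota y|) ^+ 2.
  by rewrite hipxx linearD lerXn2r ?nnegrE ?addr_ge0//; exact: ler_normD.
rewrite hipDl !hipDr (hipC y x) !hipxx; lra.
Qed.

(** For [u] on the sphere, the projection onto the tangent space at [u] that is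
    orthogonal for the inner product of [H].  Dividing by [mu] instead of
    [`|iota u| ^+ 2] makes it polynomial in [u], hence locally Lipschitz, without
    any condition on [u]. *)
Definition tproj (u e : E) : E := e - (hip u e / mu) *: u.

Lemma tprojD u e f : tproj u (e + f) = tproj u e + tproj u f.
Proof. by rewrite /tproj hipDr mulrDl scalerDl opprD addrACA. Qed.

Lemma tprojZ u a e : tproj u (a *: e) = a *: tproj u e.
Proof. by rewrite /tproj hipZr -mulrA -scalerA scalerBr. Qed.

Lemma tproj_tangent u e : sphere iota mu u -> hip u (tproj u e) = 0.
Proof.
by rewrite /sphere /= => su; rewrite hipBr hipZr hipxx su divfK ?subrr// gt_eqF.
Qed.

Lemma tproj_id u e : hip u e = 0 -> tproj u e = e.
Proof. by move=> ue; rewrite /tproj ue mul0r scale0r subr0. Qed.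

Lemma norm_tproj r u e : `|u| <= r -> `|tproj u e| <= (1 + r ^+ 2 / mu) * `|e|.
Proof.
move=> ur; rewrite (le_trans (ler_normB _ _))// mulrDl mul1r lerD2l normrZ.
rewrite normrM normfV (gtr0_norm mu_gt0) mulrAC [leRHS]mulrAC.
rewrite ler_wpM2r ?invr_ge0 ?(ltW mu_gt0)//.
have r0 : 0 <= r by exact: le_trans ur.
rewrite (le_trans (ler_wpM2r (normr_ge0 _) (hip_le u e)))//.
by rewrite mulrAC ler_wpM2r// expr2 ler_pM.
Qed.

(** The difference is that of two values of a quadratic map, written as in the
    product rule. *)
Lemma tproj_lipschitz r u v e : `|u| <= r -> `|v| <= r ->
  `|tproj u e - tproj v e| <= 2 * r / mu * `|u - v| * `|e|.
Proof.
move=> ur vr; have r0 : 0 <= r by exact: le_trans ur.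
have -> : tproj u e - tproj v e =
    - (mu^-1 *: (hip (u - v) e *: u + hip v e *: (u - v))).
  rewrite scalerDr !scalerA hipBl ![mu^-1 * _]mulrC mulrBl scalerBl scalerBr.
  by rewrite subrKA opprB /tproj opprB addrC subrKA.
rewrite normrN normrZ normfV (gtr0_norm mu_gt0).
rewrite (_ : 2 * r / mu * `|u - v| * `|e| = mu^-1 * (2 * r * `|u - v| * `|e|));
  last by ring.
rewrite ler_wpM2l ?invr_ge0 ?(ltW mu_gt0)//.
rewrite (le_trans (ler_normD _ _))// !normrZ.
have h1 := ler_pM (normr_ge0 _) (normr_ge0 _) (hip_le (u - v) e) ur.
have h2 := ler_wpM2r (normr_ge0 (u - v)) (hip_le v e).
have h3 := ler_wpM2r (mulr_ge0 (normr_ge0 e) (normr_ge0 (u - v))) vr.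
by apply: (le_trans (lerD h1 h2)); lra.
Qed.

Definition to_sphere (v : E) : E := (Num.sqrt mu / `|iota v|) *: v.

Lemma to_sphere_in v : iota v != 0 -> sphere iota mu (to_sphere v).
Proof.
move=> v0; rewrite /sphere /to_sphere /= linearZ/= normrZ normrM normfV normr_id.
rewrite divfK ?normr_eq0// ger0_norm ?sqrtr_ge0// sqr_sqrtr//; exact: ltW.
Qed.

Lemma to_sphere_id v : sphere iota mu v -> to_sphere v = v.
Proof.
rewrite /sphere /to_sphere /= => sv.
have v0 : 0 < `|iota v|.
  rewrite normr_gt0; apply: contraTneq mu_gt0 => v0.
  by rewrite -sv v0 normr0 expr0n ltxx.
by rewrite -sv sqrtr_sqr normr_id divff ?scale1r// gt_eqF.
Qed.

Lemma sphere_add_tangent u x : sphere iota mu u -> hip u x = 0 ->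
  `|iota (u + x)| ^+ 2 = mu + `|iota x| ^+ 2.
Proof.
rewrite /sphere /= => su ux.
by rewrite -hipxx hipDl !hipDr (hipC x u) ux !hipxx addr0 add0r su.
Qed.

Lemma sphere_add_tangent_neq0 u x : sphere iota mu u -> hip u x = 0 ->
  iota (u + x) != 0.
Proof.
move=> su ux; apply: contraTneq mu_gt0 => i0.
have := sphere_add_tangent su ux; rewrite i0 normr0 expr0n/= -leNgt.
by have := sqr_ge0 `|iota x|; lra.
Qed.

(** Here [a = (1 + X / mu)^(-1/2)] is the factor that brings a tangent step of
    squared length [X] back to the sphere.  The estimates come from
    [(1 - a) * (1 + a) * (mu + X) = X]. *)
Lemma normalizer_expansion (a X : R) : 0 <= a -> 0 <= X ->
    a ^+ 2 * (mu + X) = mu ->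
  [/\ 0 <= 1 - a, 1 - a <= X / mu &
      `|1 - a - X / (2 * mu)| <= 3 * X ^+ 2 / (2 * mu ^+ 2)].
Proof.
move=> a0 X0 aX.
have a1 : a <= 1.
  rewrite leNgt; apply/negP => a1.
  have a2 : 0 < a ^+ 2 - 1 by rewrite subr_gt0 exprn_egt1.
  have := mulr_gt0 mu_gt0 a2; have := mulr_ge0 X0 (sqr_ge0 a); lra.
have b0 : 0 <= 1 - a by rewrite subr_ge0.
have amu : 0 <= a * (mu + X) by rewrite mulr_ge0// addr_ge0// ltW.
have aX0 := mulr_ge0 a0 X0.
have bE : (1 - a) * ((1 + a) * (mu + X)) = X by lra.
have bX : (1 - a) * mu <= X.
  by rewrite -[leRHS]bE ler_wpM2l//; lra.
split => //; first by rewrite ler_pdivlMr.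
have mu2 : 0 < 2 * mu ^+ 2 by rewrite mulr_gt0// exprn_gt0.
rewrite ler_pdivlMr// -[X in _ * X](gtr0_norm mu2) -normrM.
have -> : (1 - a - X / (2 * mu)) * (2 * mu ^+ 2) =
    ((1 - a) * mu) * (mu * (1 - a) - X * (1 + a)).
  transitivity (mu * ((1 - a) * 2 * mu - X)); first by field; rewrite gt_eqF.
  by rewrite -[in LHS]bE; ring.
rewrite normrM ger0_norm; last by rewrite mulr_ge0// ltW.
rewrite (_ : 3 * X ^+ 2 = X * (3 * X)); last by ring.
apply: ler_pM => //; first by rewrite mulr_ge0// ltW.
have h1 := mulr_ge0 X0 b0; have h2 := mulr_ge0 (ltW mu_gt0) b0.
by rewrite ler_norml; apply/andP; split; lra.
Qed.

Variable phi : E -> R^o.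
Hypothesis phi_C2 : unif_C2 phi.
Local Notation d1phi := (frechet phi).
Local Notation d2phi := (frechet (frechet phi)).

(** The normalisation moves [u + x] by [- (X / (2 * mu)) *: u] up to terms of third
    order, where [X = `|iota x| ^+ 2].  Through the first differential this
    contributes exactly the correction by which [D2] differs from the second
    differential, so [D2] is the second variation along the sphere. *)
Lemma taylor2_tangent (r sigma : R) : 0 < sigma ->
  exists2 d, 0 < d & forall u x, sphere iota mu u -> `|u| <= r ->
    hip u x = 0 -> `|x| <= d ->
    phi (to_sphere (u + x)) <= phi u + frechet phi u x
      + D2 iota phi u x x / 2 + sigma * `|x| ^+ 2.
Proof.
move=> sigma0; have [_ _ [_ d1_bounded] [_ d2_bounded]] := phi_C2.
have [r0|r0] := ltP r 0.
  by exists 1 => // u x _ ur; have := le_trans (normr_ge0 u) ur; rewrite leNgt r0.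
have [K1 K10 hK1] := d1_bounded r; have [K2 K20 hK2] := d2_bounded r.
pose D := (r + 1) / mu.
have D0 : 0 <= D by rewrite divr_ge0 ?addr_ge0// ltW.
have D1p : 0 < 1 + D by rewrite ltr_wpDr.
have s'0 : 0 < sigma / (2 * (1 + D) ^+ 2).
  by rewrite divr_gt0// mulr_gt0// exprn_gt0.
have [d d0 hT] := taylor2 r phi_C2 s'0.
(* [Q] collects the coefficients of all terms of third order in [`|x|]. *)
pose Q := 3 * K1 * r / (2 * mu ^+ 2) + K1 / mu + K2 * D * (2 + D) / 2.
have q1 : 0 <= 3 * K1 * r / (2 * mu ^+ 2).
  by rewrite divr_ge0// ?mulr_ge0// ?sqr_ge0// ltW.
have q2 : 0 <= K1 / mu by rewrite divr_ge0// ltW.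
have q3 : 0 <= K2 * D * (2 + D) / 2.
  by rewrite divr_ge0// mulr_ge0 ?addr_ge0// mulr_ge0// ltW.
have Q0 : 0 <= Q by rewrite /Q !addr_ge0.
have Q1p : 0 < Q + 1 by rewrite ltr_wpDl.
exists (Num.min 1 (Num.min (d / (1 + D)) (sigma / (2 * (Q + 1))))).
  by rewrite !lt_min ltr01 /= !divr_gt0// mulr_gt0.
move=> u x su ur ux.
rewrite !le_min => /and3P[n1 nd ns].
set n := `|x| in n1 nd ns *.
have n0 : 0 <= n by exact: normr_ge0.
pose X := `|iota x| ^+ 2.
have X0 : 0 <= X by exact: sqr_ge0.
have Xn : X <= n ^+ 2 by rewrite /X lerXn2r ?nnegrE//; exact: iota_le.
have muX : `|iota (u + x)| ^+ 2 = mu + X by exact: sphere_add_tangent.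
have i0 : 0 < `|iota (u + x)| by rewrite normr_gt0 sphere_add_tangent_neq0.
pose a := Num.sqrt mu / `|iota (u + x)|.
have a0 : 0 <= a by rewrite divr_ge0 ?sqrtr_ge0.
have [] := normalizer_expansion a0 X0.
  by rewrite expr_div_n sqr_sqrtr ?(ltW mu_gt0)// muX divfK// gt_eqF// ltr_wpDr.
pose b := 1 - a; rewrite -/b => b0 bX bX2.
have bn : b <= n ^+ 2 / mu.
  by rewrite (le_trans bX)// ler_wpM2r// invr_ge0 ltW.
pose h := x - b *: (u + x).
have tsE : to_sphere (u + x) = u + h.
  by rewrite /to_sphere -/a /h /b scalerBl scale1r opprB addrA addrC subrK.
have uxn : `|u + x| <= r + 1.
  by rewrite (le_trans (ler_normD _ _))// lerD.
have hx : `|h - x| <= n ^+ 2 * D.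
  rewrite /h addrAC subrr add0r normrN normrZ ger0_norm//.
  by rewrite /D mulrCA mulrC; apply: ler_pM.
have n2n : n ^+ 2 <= n by rewrite expr2 ler_piMl.
have hn : `|h| <= n * (1 + D).
  rewrite -(subrK x h) (le_trans (ler_normD _ _))// mulrDr mulr1 addrC lerD2l.
  by rewrite (le_trans hx)// ler_wpM2r.
have hd : `|h| <= d.
  by rewrite (le_trans hn)// -ler_pdivlMr// ltr_wpDr.
have := hT u h ur hd; rewrite ler_norml => /andP[_].
have h2 : sigma / (2 * (1 + D) ^+ 2) * `|h| ^+ 2 <= sigma / 2 * n ^+ 2.
  have : `|h| ^+ 2 <= (n * (1 + D)) ^+ 2.
    by rewrite lerXn2r ?nnegrE// mulr_ge0// addr_ge0.
  move=> /(ler_wpM2l (ltW s'0)) /le_trans; apply.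
  rewrite le_eqVlt; apply/orP; left; apply/eqP; field.
  by rewrite gt_eqF// ltr_wpDr.
have d1u v : `|d1phi u v : R| <= K1 * `|v|.
  by rewrite (le_trans (op_norm_apply _ _))// ler_wpM2r// hK1.
have d2u v w : `|d2phi u v w : R| <= K2 * `|v| * `|w|.
  rewrite (le_trans (op_norm_apply2 _ _ _))// ler_wpM2r// ler_wpM2r// hK2//.
have d1h : d1phi u h = d1phi u x - b * d1phi u u - b * d1phi u x :> R.
  by rewrite /h linearB linearZ linearD /= /GRing.scale /=; ring.
have n3 : n ^+ 3 = n * n ^+ 2 by rewrite exprS.
have e1 : - (b * d1phi u u) <=
    - (X / (2 * mu) * d1phi u u) + n ^+ 3 * (3 * K1 * r / (2 * mu ^+ 2)) :> R.
  have dr : `|d1phi u u : R| <= K1 * r.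
    by rewrite (le_trans (d1u u))// ler_wpM2l// ltW.
  have X3 : X ^+ 2 <= n ^+ 3.
    by rewrite n3 expr2 ler_pM// (le_trans Xn).
  have := ler_pM (normr_ge0 _) (normr_ge0 _) bX2 dr.
  rewrite -normrM => /ler_normlP[+ _].
  have -> : 3 * X ^+ 2 / (2 * mu ^+ 2) * (K1 * r) =
    X ^+ 2 * (3 * K1 * r / (2 * mu ^+ 2)) by ring.
  have := ler_wpM2r q1 X3; lra.
have e2 : - (b * d1phi u x) <= n ^+ 3 * (K1 / mu) :> R.
  have nb : `|b| <= n ^+ 2 / mu by rewrite ger0_norm.
  have := ler_pM (normr_ge0 _) (normr_ge0 _) nb (d1u x).
  by rewrite -normrM -/n => /ler_normlP[+ _] => /le_trans; apply; rewrite n3; lra.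
have e3 : d2phi u h h <= d2phi u x x + n ^+ 3 * (K2 * D * (2 + D)) :> R.
  have -> : d2phi u h h =
      d2phi u x x + (d2phi u (h - x) h + d2phi u x (h - x)) :> R.
    rewrite [d2phi u (h - x)]linearB [d2phi u x (h - x)]linearB bounded_linearB.
    by ring.
  rewrite lerD2l.
  have p1 : `|d2phi u (h - x) h : R| <= K2 * (n ^+ 2 * D) * (n * (1 + D)).
    by rewrite (le_trans (d2u _ _))// ler_pM ?mulr_ge0 ?ler_wpM2l// ltW.
  have p2 : `|d2phi u x (h - x) : R| <= K2 * n * (n ^+ 2 * D).
    by rewrite (le_trans (d2u _ _))// ler_wpM2l// mulr_ge0// ltW.
  move: p1 p2 => /ler_normlP[_ p1] /ler_normlP[_ p2].
  by apply: (le_trans (lerD p1 p2)); rewrite n3; lra.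
have e4 : n ^+ 3 * Q <= sigma / 2 * n ^+ 2.
  rewrite n3 mulrAC ler_wpM2r ?sqr_ge0//.
  move: ns; rewrite ler_pdivlMr ?mulr_gt0//.
  by move=> ns; rewrite ler_pdivlMr//; move: ns n0; lra.
rewrite tsE /D2 -/(hip x x) hipxx -/X.
have -> : `|iota u| ^+ 2 = mu by [].
move: e1 e2 e3 e4 h2 d1h; rewrite -/n /Q.
have -> : X / (2 * mu) * d1phi u u = d1phi u u / mu * X / 2 :> R.
  by field; rewrite gt_eqF.
lra.
Qed.

End SphereGeometry.

(** * First and second variations along the sphere *)

Section TangentialForms.
Context {R : realType} {E H : hilbertType R}.
Variable iota : {linear E -> H}.
Hypothesis iota_le : forall u, `|iota u| <= `|u|.
Variable mu : R.
Hypothesis mu_gt0 : 0 < mu.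
Variable phi : E -> R^o.
Hypothesis phi_C2 : unif_C2 phi.
Local Notation d1phi := (frechet phi).
Local Notation d2phi := (frechet (frechet phi)).
Local Notation P := (tproj iota mu).

(** The differential of [phi] on the sphere and the form [D2], both precomposed
    with the tangential projection: they are then defined for all directions of
    [E], so that one direction can be used at neighbouring points of a path. *)
Definition tdiff (u e : E) : R := d1phi u (P u e).

(** In this form [mu] replaces [`|iota u| ^+ 2], which agrees with [D2] on the
    sphere and makes the dependence on [u] uniform. *)
Definition thess (u e f : E) : R :=
  (d2phi u (P u e) (P u f) : R) -
  (d1phi u u : R) / mu * hip iota (P u e) (P u f).

Lemma tdiffD u e f : tdiff u (e + f) = tdiff u e + tdiff u f.
Proof. by rewrite /tdiff tprojD linearD. Qed.

Lemma tdiffZ u a e : tdiff u (a *: e) = a * tdiff u e.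
Proof. by rewrite /tdiff tprojZ linearZ. Qed.

Lemma thessDl u e e' f : thess u (e + e') f = thess u e f + thess u e' f.
Proof.
by rewrite /thess tprojD [d2phi u (_ + _)]linearD bounded_linearD hipDl; ring.
Qed.

Lemma thessDr u e f f' : thess u e (f + f') = thess u e f + thess u e f'.
Proof. by rewrite /thess tprojD linearD hipDr /=; ring. Qed.

Lemma thessZl u a e f : thess u (a *: e) f = a * thess u e f.
Proof.
rewrite /thess tprojZ [d2phi u (_ *: _)]linearZ bounded_linearZ hipZl.
by rewrite /GRing.scale /=; ring.
Qed.

Lemma thessZr u a e f : thess u e (a *: f) = a * thess u e f.
Proof.
rewrite /thess tprojZ hipZr.
have -> : (d2phi u (P u e) (a *: P u f) : R) =
  a * (d2phi u (P u e) (P u f) : R) by exact: linearZ.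
by ring.
Qed.

Lemma thessE u v : sphere iota mu u -> hip iota u v = 0 ->
  thess u v v = D2 iota phi u v v.
Proof.
move=> su uv; rewrite /thess /D2 !tproj_id//.
by move: su; rewrite /sphere /= => ->.
Qed.

Lemma thess_bounded r : exists2 K, 0 < K & forall u e f, `|u| <= r ->
  `|e| <= 1 -> `|f| <= 1 -> `|thess u e f| <= K.
Proof.
have [_ _ [_ d1_bounded] [_ d2_bounded]] := phi_C2.
have [r0|r0] := ltP r 0.
  by exists 1 => // u e f ur; have := le_trans (normr_ge0 u) ur; rewrite leNgt r0.
have [K1 K10 hK1] := d1_bounded r; have [K2 K20 hK2] := d2_bounded r.
pose C := 1 + r ^+ 2 / mu.
have C0 : 0 < C by rewrite ltr_pwDl// divr_ge0 ?sqr_ge0// ltW.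
exists (K2 * C * C + K1 * r / mu * (C * C)).
  rewrite ltr_pwDl ?mulr_gt0// mulr_ge0 ?divr_ge0 ?mulr_ge0//; exact: ltW.
move=> u e f ur e1 f1; rewrite /thess.
have PC g : `|g| <= 1 -> `|P u g| <= C.
  move=> g1; apply: le_trans (norm_tproj iota_le mu_gt0 g ur) _.
  by rewrite ler_piMr// ltW.
rewrite (le_trans (ler_normB _ _))// lerD//.
  rewrite (le_trans (op_norm_apply2 _ _ _))//.
  by rewrite ler_pM ?mulr_ge0 ?PC// ler_pM ?PC// hK2.
rewrite normrM ler_pM//.
  rewrite normrM normfV (gtr0_norm mu_gt0) ler_wpM2r ?invr_ge0 ?(ltW mu_gt0)//.
  by rewrite (le_trans (op_norm_apply _ _))// ler_pM// hK1.
by rewrite (le_trans (hip_le iota_le _ _))// ler_pM ?PC.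
Qed.

(** Each form is a sum of products of factors that are bounded and uniformly
    continuous on the ball; the modulus [om / A] makes the sum of the errors, each
    linear in the modulus, at most [om]. *)
Lemma tforms_unif_cont r om : 0 < om -> exists2 d, 0 < d &
  forall u v, `|u| <= r -> `|v| <= r -> `|u - v| <= d ->
  forall e f, `|e| <= 1 -> `|f| <= 1 ->
    `|tdiff u e - tdiff v e| <= om /\ `|thess u e f - thess v e f| <= om.
Proof.
have [_ _ [d1_uc d1_bounded] [d2_uc d2_bounded]] := phi_C2.
move=> om0.
have [r0|r0] := ltP r 0.
  by exists 1 => // u e ur; have := le_trans (normr_ge0 u) ur; rewrite leNgt r0.
have [K1 K10 hK1] := d1_bounded r; have [K2 K20 hK2] := d2_bounded r.
pose C := 1 + r ^+ 2 / mu; pose L := 2 * r / mu.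
have C0 : 0 < C by rewrite ltr_pwDl// divr_ge0 ?sqr_ge0// ltW.
have L0 : 0 <= L by rewrite divr_ge0 ?mulr_ge0// ltW.
pose A1 := C + K1 * L.
pose A2 := C * C + K2 * L * C + K2 * C * L +
  ((r + K1) * (C * C) + K1 * r * (L * C + C * L)) / mu.
pose A := A1 + A2.
have A10 : 0 < A1 by rewrite ltr_pwDl// mulr_ge0// ltW.
have [C0w K1w K2w muw] : [/\ 0 <= C, 0 <= K1, 0 <= K2 & 0 <= mu].
  by split; exact: ltW.
have A20 : 0 < A2.
  have a1 := mulr_gt0 C0 C0.
  have a2 := mulr_ge0 (mulr_ge0 K2w L0) C0w.
  have a3 := mulr_ge0 (mulr_ge0 K2w C0w) L0.
  have a4 : 0 <= ((r + K1) * (C * C) + K1 * r * (L * C + C * L)) / mu.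
    have b1 := mulr_ge0 C0w L0; have b2 := mulr_ge0 L0 C0w.
    by rewrite divr_ge0// addr_ge0// mulr_ge0// ?mulr_ge0// addr_ge0.
  by rewrite /A2; lra.
have A0 : 0 < A by rewrite addr_gt0.
pose t := om / A; have t0 : 0 < t by rewrite divr_gt0.
have [d1 d10 h1] := d1_uc r _ t0; have [d2 d20 h2] := d2_uc r _ t0.
exists (Num.min t (Num.min d1 d2)); first by rewrite !lt_min t0 d10.
move=> u v ur vr; rewrite !le_min => /and3P[uvt uv1 uv2] e f e1 f1.
have {}h1 := h1 u v ur vr uv1; have {}h2 := h2 u v ur vr uv2.
have PC w g : `|w| <= r -> `|g| <= 1 -> `|P w g| <= C.
  move=> wr g1; apply: le_trans (norm_tproj iota_le mu_gt0 g wr) _.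
  by rewrite ler_piMr// ltW.
have PL g : `|g| <= 1 -> `|P u g - P v g| <= L * t.
  move=> g1; apply: le_trans (tproj_lipschitz iota_le mu_gt0 g ur vr) _.
  rewrite -[leRHS]mulr1; apply: ler_pM => //; first exact: mulr_ge0.
  exact: ler_wpM2l.
have step1 (x y : E) a b : `|x| <= a -> `|x - y| <= b ->
    `|d1phi u x - d1phi v y : R| <= t * a + K1 * b.
  move=> xa xb.
  rewrite bounded_linear_apply_sub.
  rewrite (le_trans (ler_normD _ _))// lerD// (le_trans (op_norm_apply _ _))//.
    by rewrite ler_pM.
  by rewrite ler_pM// hK1.
split.
  rewrite /tdiff (le_trans (step1 _ _ _ _ (PC _ _ ur e1) (PL _ e1)))//.
  have -> : t * C + K1 * (L * t) = A1 * t by rewrite /A1; ring.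
  rewrite /t mulrCA ger_pMr// ler_pdivrMr// mul1r /A lerDl; exact: ltW.
rewrite /thess.
move: (PC _ _ ur e1) (PC _ _ vr e1) (PC _ _ ur f1) (PC _ _ vr f1).
move: (PL _ e1) (PL _ f1).
move: (P u e) (P v e) (P u f) (P v f).
move=> x x' y y' xL yL xC xC' yC yC'.
have p1 : `|d2phi u x y - d2phi v x' y' : R| <=
    t * C * C + K2 * (L * t) * C + K2 * C * (L * t).
  rewrite bilinear_apply_sub.
  rewrite (le_trans (ler_normD _ _))// lerD//.
    rewrite (le_trans (ler_normD _ _))// lerD// (le_trans (op_norm_apply2 _ _ _))//.
      by rewrite ler_pM ?mulr_ge0 ?ler_pM.
    by rewrite ler_pM ?mulr_ge0 ?ler_pM// hK2.
  by rewrite (le_trans (op_norm_apply2 _ _ _))// ler_pM ?mulr_ge0 ?ler_pM// hK2.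
pose a : R := d1phi u u; pose b : R := d1phi v v.
have p2 : `|a * hip iota x y - b * hip iota x' y'| <=
   (t * r + K1 * t) * (C * C) + K1 * r * (L * t * C + C * (L * t)).
  have -> : a * hip iota x y - b * hip iota x' y' = (a - b) * hip iota x y +
      b * (hip iota (x - x') y + hip iota x' (y - y')).
    by rewrite hipBl hipBr; ring.
  rewrite (le_trans (ler_normD _ _))// !normrM lerD// ler_pM//.
  - exact: step1.
  - by rewrite (le_trans (hip_le iota_le _ _))// ler_pM.
  - by rewrite (le_trans (op_norm_apply _ _))// ler_pM// hK1.
  - rewrite (le_trans (ler_normD _ _))// lerD// (le_trans (hip_le iota_le _ _))//.
      by rewrite ler_pM.
    by rewrite ler_pM.
have regroup (a1 b1 p q h h' : R) :
    p - a1 / mu * h - (q - b1 / mu * h') = (p - q) - (a1 * h - b1 * h') / mu.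
  by ring.
rewrite regroup.
rewrite (le_trans (ler_normB _ _))//.
rewrite normrM normfV (gtr0_norm mu_gt0).
have im0 : 0 <= mu^-1 by rewrite invr_ge0 ltW.
have := lerD p1 (ler_wpM2r im0 p2) => /le_trans; apply.
have -> : t * C * C + K2 * (L * t) * C + K2 * C * (L * t) +
  ((t * r + K1 * t) * (C * C) + K1 * r * (L * t * C + C * (L * t))) / mu = A2 * t.
  by rewrite /A2; ring.
by rewrite /t mulrCA ger_pMr// ler_pdivrMr// mul1r /A lerDr; exact: ltW.
Qed.

End TangentialForms.

(** * Functions of a real parameter *)

Section RealParameter.
Context {R : realType}.

Lemma segment_unif_continuous {W : normedModType R} (f : R -> W) (a b e : R) :
  continuous f -> 0 < e -> exists2 d, 0 < d &
    forall x y, a <= x -> x <= b -> `|x - y| <= d -> `|f x - f y| <= e.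
Proof.
move=> cf e0.
have e2 : 0 < e / 2 by rewrite divr_gt0.
have /compact_near_coveringP cover := @segment_compact R a b.
have [] := @filter_ex _ (0^'+ : set_system R) _ _ (filterI (nbhs_right_gt 0)
  (cover _ (0^'+ : set_system R)
    (fun d x => forall y, `|x - y| <= d -> `|f x - f y| <= e) _ _)).
  move=> x _.
  have := cf x; move=> /cvgrPdist_le/(_ _ e2)/nbhs_normP[d /= d0 hd].
  have d2 : 0 < d / 2 by rewrite divr_gt0.
  exists (ball x (d / 2), [set t | t < d / 2]) => /=.
    by split; [exact: nbhsx_ballx|exact: nbhs_right_lt].
  move=> [x' t] /= [xx' td] y x'y.
  move: xx'; rewrite -ball_normE /= => xx'.
  rewrite [e]splitr -(subrKA (f x)) (le_trans (ler_normD _ _))// lerD//.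
    by rewrite distrC; apply: hd; rewrite /= (lt_trans xx')// ltr_pdivrMr//; lra.
  apply: hd; rewrite /= -(subrKA x') (le_lt_trans (ler_normD _ _))// [d]splitr.
  by rewrite ltrD// (le_lt_trans x'y).
move=> d [d0 hd]; exists d => // x y ax xb; apply: hd.
by rewrite /= in_itv/= ax.
Qed.

(** Precomposition with this retraction turns a path on [0, 1] into a function
    continuous on the whole line; it also serves as a cutoff of values. *)
Definition clamp01 (t : R) : R := Num.max 0 (Num.min t 1).

Lemma clamp01_itv t : 0 <= clamp01 t <= 1.
Proof. by rewrite /clamp01 le_max lexx ge_max ler01 ge_min lexx orbT. Qed.

Lemma clamp01_id t : 0 <= t -> t <= 1 -> clamp01 t = t.
Proof. by move=> t0 t1; rewrite /clamp01 min_l// max_r. Qed.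

Lemma clamp01_le0 t : t <= 0 -> clamp01 t = 0.
Proof. by move=> t0; rewrite /clamp01 max_l// ge_min t0. Qed.

Lemma clamp01_ge1 t : 1 <= t -> clamp01 t = 1.
Proof. by move=> t1; rewrite /clamp01 min_r// max_r. Qed.

Lemma continuous_clamp01 : continuous clamp01.
Proof.
have -> : clamp01 = (cst 0 \max (id \min cst 1)) by [].
move=> t; apply: continuous_max; first exact: cst_continuous.
by apply: continuous_min; [exact: cvg_id|exact: cst_continuous].
Qed.

Definition hat (N k : nat) (t : R) : R := Num.max 0 (1 - `|N%:R * t - k%:R|).

Lemma piecewise_linear {V : normedModType R} (N : nat) (e : nat -> V) :
  exists2 p : R -> V, continuous p & forall i t, (i < N)%N ->
    0 <= N%:R * t - i%:R <= 1 ->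
    p t = (1 - (N%:R * t - i%:R)) *: e i + (N%:R * t - i%:R) *: e i.+1.
Proof.
(* At a point between two nodes only the two corresponding hats survive. *)
exists (fun t => \sum_(k < N.+1) hat N k t *: e k).
  have -> : (fun t => \sum_(k < N.+1) hat N k t *: e k) =
    \sum_(k < N.+1) (fun t => hat N k t *: e k).
    by apply/funext => x; rewrite fct_sumE.
  apply: (big_ind (fun F : R -> V => continuous F)).
  - exact: cst_continuous.
  - by move=> F G cF cG t; apply: cvgD; [exact: cF|exact: cG].
  move=> k _ t.
  apply: cvgZ; last exact: cvg_cst.
  have -> : hat N k = (cst 0 \max (fun t => 1 - `|N%:R * t - k%:R|)) by [].
  apply: continuous_max; first exact: cst_continuous.
  apply: cvgB; first exact: cvg_cst.
  apply: cvg_norm; apply: cvgB; last exact: cvg_cst.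
  by apply: cvgM; [exact: cvg_cst|exact: cvg_id].
move=> i t iN /andP[]; rewrite subr_ge0 => i1 ti1.
have i2 : N%:R * t <= i.+1%:R by rewrite -natr1 -lerBlDl.
have hat0 k : 1 <= `|N%:R * t - k%:R| -> hat N k t = 0.
  by move=> h; rewrite /hat max_l// subr_le0.
have iN1 : (i < N.+1)%N by exact: leqW.
rewrite (bigD1 (Ordinal iN1))//=.
rewrite (bigD1 (Ordinal (iN : (i.+1 < N.+1)%N)))/=; last first.
  by rewrite -val_eqE /= gtn_eqF.
rewrite big1 ?addr0; last first.
  move=> k /andP[ki ki1]; rewrite hat0 ?scale0r//.
  move: ki ki1; rewrite -!val_eqE /= => ki ki1.
  have [k1|k1] := ltnP k i.
    rewrite ger0_norm; last by rewrite subr_ge0 (le_trans _ i1)// ler_nat ltnW.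
    have : k.+1%:R <= i%:R :> R by rewrite ler_nat.
    rewrite -natr1; lra.
  have {}k1 : (i.+2 <= k)%N by rewrite ltn_neqAle eq_sym ki1 ltn_neqAle eq_sym ki.
  have : i.+2%:R <= k%:R :> R by rewrite ler_nat.
  move: i2; rewrite -!natr1 => i2 k2.
  by rewrite ler0_norm; lra.
move: i2; rewrite -natr1 => i2.
congr (_ *: _ + _ *: _); rewrite /hat.
  by rewrite ger0_norm ?subr_ge0// max_r//; lra.
by rewrite -natr1 ler0_norm ?max_r; lra.
Qed.

Lemma grid_index (N : nat) (t : R) : (0 < N)%N -> 0 <= t -> t <= 1 ->
  exists i, [/\ (i < N)%N, 0 <= N%:R * t - i%:R <= 1,
    `|t - i%:R / N%:R| <= N%:R^-1 & `|t - i.+1%:R / N%:R| <= N%:R^-1].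
Proof.
move=> N0 t0 t1; have NR : 0 < N%:R :> R by rewrite ltr0n.
have [i [iN i1 i2]] : exists i,
    [/\ (i < N)%N, 0 <= N%:R * t - i%:R & N%:R * t - i%:R <= 1].
  have [->|tlt1] := eqVneq t 1.
    exists N.-1; rewrite prednK// mulr1 subr_ge0 ler_nat leq_pred; split => //.
    by rewrite lerBlDr addrC natr1 prednK.
  have {}tlt1 : t < 1 by rewrite lt_neqAle tlt1.
  have /truncn_itv/andP[h1 h2] : 0 <= N%:R * t by rewrite mulr_ge0.
  exists (Num.truncn (N%:R * t)); split; last 2 first.
  - by rewrite subr_ge0.
  - by rewrite lerBlDr addrC natr1 ltW.
  by rewrite -(ltr_nat R) (le_lt_trans h1)// gtr_pMr.
exists i; split => //; first by rewrite i1.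
all: rewrite -(ler_pM2l NR) divff ?gt_eqF// -[X in X * _](gtr0_norm NR) -normrM.
all: rewrite mulrBr [N%:R * (_ / _)]mulrC divfK ?gt_eqF//.
  by rewrite ger0_norm.
by rewrite -natr1 ler_norml; apply/andP; split; lra.
Qed.

Lemma exists_invn_le (m : R) : 0 < m ->
  exists2 N : nat, (0 < N)%N & (N%:R^-1 : R) <= m.
Proof.
move=> m0; exists (Num.truncn m^-1).+1 => //.
have /truncn_itv/andP[_ /ltW h] : 0 <= m^-1 by rewrite invr_ge0 ltW.
by rewrite invf_ple ?posrE ?ltr0n.
Qed.

Lemma norm_interpolation_le1 {V : normedModType R} (x y : V) (tau : R) :
  0 <= tau <= 1 -> `|x| <= 1 -> `|y| <= 1 ->
  `|(1 - tau) *: x + tau *: y| <= 1.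
Proof.
move=> /andP[t0 t1] x1 y1; rewrite -subr_ge0 in t1.
rewrite -[leRHS](subrK tau) (le_trans (ler_normD _ _))// !normrZ.
by rewrite (ger0_norm t0) (ger0_norm t1) lerD// ler_piMr.
Qed.

End RealParameter.

(** * Descent directions *)

Section IndependentPairs.
Context {R : realType} {V : lmodType R}.

Definition independent_pair (v w : V) :=
  forall a b : R, a *: v + b *: w = 0 -> a = 0 /\ b = 0.

Lemma edim_gt1 (L : set V) : (1 < edim L)%E ->
  exists v w, [/\ L v, L w & independent_pair v w].
Proof.
move=> /ereal_sup_gt[_ [n [e e_indep Le] <-]].
rewrite lte_fin ltr1n => n1.
have n0 : (0 < n)%N by exact: ltnW.
pose i0 := Ordinal n0; pose i1 := Ordinal n1.
exists (e i0), (e i1); split => // a b ab0.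
have i01 : i1 != i0 by [].
have h := e_indep (fun i => if i == i0 then a else if i == i1 then b else 0).
have sum0 : \sum_(i < n)
    (if i == i0 then a else if i == i1 then b else 0) *: e i = 0.
  rewrite (bigD1 i0)//= (bigD1 i1)//= ?eqxx ?(negbTE i01) ?eqxx big1 ?addr0//.
  by move=> i /andP[/negbTE -> /negbTE ->]; rewrite scale0r.
move: (h sum0 i0) (h sum0 i1).
by rewrite /= ?eqxx ?(negbTE i01).
Qed.

(** A plane contains a nonzero [x] with [f x = 0], and either [x] or [- x] satisfies
    the inequality for [g]. *)
Lemma two_linear_inequalities (L : set V) (f g : V -> R) (v w : V) :
  linear_subspace L -> scalar f -> scalar g -> L v -> L w ->
  independent_pair v w ->
  exists x, [/\ L x, x != 0, f x <= 0 & g x <= 0].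
Proof.
move=> [L0 Llin] fl gl Lv Lw vw.
have LZ a x : L x -> L (a *: x).
  by move=> Lx; rewrite -[_ *: _]addr0; exact: Llin.
have lin0 (h : V -> R) : scalar h -> h 0 = 0.
  by move=> hl; have := hl 1 0 0; rewrite scaler0 addr0 mul1r; lra.
have linZ (h : V -> R) a x : scalar h -> h (a *: x) = a * h x.
  by move=> hl; have := hl a x 0; rewrite lin0// !addr0.
suff [x [Lx x0 fx]] : exists x, [/\ L x, x != 0 & f x = 0].
  have [gx|gx] := leP (g x) 0; first by exists x; rewrite fx.
  exists (- 1 *: x); split; first exact: LZ.
  - by rewrite scaler_eq0 negb_or x0 oppr_eq0 oner_eq0.
  - by rewrite linZ// fx mulr0.
  - by rewrite linZ// mulN1r oppr_le0 ltW.
have [fv0|fv0] := eqVneq (f v) 0.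
  exists v; split => //; apply/eqP => v0.
  have [] := vw 1 0; first by rewrite v0 scaler0 scale0r addr0.
  by move=> /eqP; rewrite oner_eq0.
exists (f w *: v + (- f v) *: w); split.
- by apply: Llin => //; exact: LZ.
- apply/eqP => /vw[_ /eqP]; rewrite oppr_eq0; exact/negP.
- by rewrite fl linZ//; ring.
Qed.

End IndependentPairs.

Section DescentDirections.
Context {R : realType} {E H : hilbertType R}.
Variable iota : {linear E -> H}.
Hypothesis iota_le : forall u, `|iota u| <= `|u|.
Variable mu : R.
Hypothesis mu_gt0 : 0 < mu.
Variable phi : E -> R^o.
Hypothesis phi_C2 : unif_C2 phi.
Local Notation ell := (tdiff iota mu phi).
Local Notation hess := (thess iota mu phi).

Lemma scalar_tdiff u : scalar (ell u).
Proof. by move=> a x y; rewrite tdiffD tdiffZ. Qed.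

Lemma scalar_thess_sym u e : scalar (fun f => hess u e f + hess u f e).
Proof. by move=> a x y; rewrite thessDr thessDl thessZr thessZl; ring. Qed.

(** [e'] lowers the quadratic model at [u] by [kappa] for the step [s].  The sign of
    the first variation ensures that shorter steps do not raise the model.  The
    last condition makes the model negative on the segment from [e] to [e'], once
    [e] also has nonpositive first variation, since it controls the mixed term of
    the expansion of the model on that segment. *)
Definition descends (s kappa : R) (u e e' : E) :=
  [/\ `|e'| <= 1, ell u e' <= 0,
      s * ell u e' + s ^+ 2 / 2 * hess u e' e' <= - kappa &
      s * ell u e' + s ^+ 2 / 2 * (hess u e e' + hess u e' e) <= 0].

(** If the constrained gradient exceeds [d], a near-maximal descent vector works,
    since its first-order gain [s * d] dominates all quadratic terms.  Otherwise
    the index is at least 2, and the first and last conditions of descent are two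
    linear inequalities on a plane where the second variation is below [- d]. *)
Lemma descent_direction (K d s : R) (u e : E) : 0 < d ->
  0 < s -> s <= 1 -> s * K <= d ->
  (forall e f, `|e| <= 1 -> `|f| <= 1 -> `|hess u e f| <= K) ->
  sphere iota mu u ->
  ~ (constrained_norm iota phi u <= d /\
     (approx_morse_index iota phi d u <= 1)%E) ->
  `|e| <= 1 -> exists e', descends s (s ^+ 2 * d / 2) u e e'.
Proof.
move=> d0 s0 s1 sK thK su ncrit e1.
have [nd|nd] := leP (constrained_norm iota phi u) d; last first.
  have [v [uv v1 dv]] := norm_on_gt d0 nd.
  have tv w : hip iota u w = 0 -> ell u w = frechet phi u w.
    by move=> uw; rewrite /tdiff tproj_id.
  have [w [w1 wd]] : exists w, `|w| <= 1 /\ ell u w < - d.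
    have [fv|fv] := leP (ell u v) 0; last first.
      exists (-1 *: v); rewrite normrZ normrN1 mul1r; split => //.
      rewrite tdiffZ mulN1r ltrN2.
      by move: dv fv; rewrite tv// => dv /gtr0_norm <-.
    exists v; split => //; move: dv fv; rewrite tv// => dv fv.
    by rewrite ltrNr -ler0_norm.
  have h1 : s ^+ 2 * K <= s * d by rewrite expr2 -mulrA ler_wpM2l// ltW.
  have s2 : 0 < s ^+ 2 by rewrite exprn_gt0.
  have h2 := ler_wpM2l (ltW s2) (le_trans (ler_norm _) (thK _ _ w1 w1)).
  have h3 := ler_wpM2l (ltW s2) (le_trans (ler_norm _) (thK _ _ w1 e1)).
  have h4 := ler_wpM2l (ltW s2) (le_trans (ler_norm _) (thK _ _ e1 w1)).
  have h5 : s * ell u w <= - (s * d) by rewrite -mulrN ler_wpM2l// ltW.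
  have h6 : s ^+ 2 * d <= s * d.
    by rewrite ler_wpM2r ?(ltW d0)// expr2 ler_piMr// ltW.
  exists w; split => //; [lra|lra|lra].
have morse : (1 < approx_morse_index iota phi d u)%E.
  by rewrite ltNge; apply/negP => m1; exact: ncrit.
have [_ [L [Lsub Lt Lneg] <-]] := ereal_sup_gt morse.
move=> /edim_gt1[v [w [Lv Lw vw]]].
have [x [Lx x0 fx gx]] := two_linear_inequalities Lsub (scalar_tdiff u)
  (scalar_thess_sym u e) Lv Lw vw.
have nx : 0 < `|x| by rewrite normr_gt0.
have ix : 0 < `|x|^-1 by rewrite invr_gt0.
have s2 : 0 < s ^+ 2 by rewrite exprn_gt0.
exists (`|x|^-1 *: x); split.
- by rewrite normrZ normfV normr_id mulVf// gt_eqF.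
- by rewrite tdiffZ pmulr_rle0.
- rewrite tdiffZ thessZl thessZr.
  have q : hess u x x <= - d * `|x| ^+ 2.
    by rewrite thessE//; [exact/ltW/Lneg|exact: Lt].
  have q' : `|x|^-1 * (`|x|^-1 * hess u x x) <= - d.
    rewrite -!ler_pdivlMl ?invrK//; apply: (le_trans q).
    by lra.
  have h1 : s * (`|x|^-1 * ell u x) <= 0 by rewrite !pmulr_rle0.
  have := ler_wpM2l (ltW s2) q'; lra.
- rewrite tdiffZ thessZl thessZr.
  have h1 : s * (`|x|^-1 * ell u x) <= 0 by rewrite !pmulr_rle0.
  have h2 : s ^+ 2 / 2 * (`|x|^-1 * (hess u e x + hess u x e)) <= 0.
    by rewrite !pmulr_rle0// divr_gt0.
  lra.
Qed.
End DescentDirections.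

(** * Pushing a path below the critical level *)

Section PathContinuity.
Context {R : realType} {E H : hilbertType R}.
Variable iota : {linear E -> H}.
Hypothesis iota_le : forall u, `|iota u| <= `|u|.

Lemma continuous_iota (f : R -> E) : continuous f -> continuous (iota \o f).
Proof.
move=> cf t; apply/cvgrPdist_le => e e0.
have := cf t => /cvgrPdist_le/(_ _ e0); apply: filterS => x.
by rewrite /= -linearB; exact/le_trans/iota_le.
Qed.

Lemma continuous_hip (f g : R -> E) : continuous f -> continuous g ->
  continuous (fun t => hip iota (f t) (g t)).
Proof.
move=> cf cg.
(* Polarisation reduces the claim to the continuity of norms. *)
have -> : (fun t => hip iota (f t) (g t)) = fun t =>
    (`|iota (f t + g t)| ^+ 2 - `|iota (f t - g t)| ^+ 2) / 4.
  apply/funext => t; rewrite -!hipxx hipBl !hipBr hipDl !hipDr.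
  by rewrite (hipC iota (g t) (f t)); field.
move=> t; apply: cvgM; last exact: cvg_cst.
apply: cvgB; apply: cvgM; apply: cvg_norm.
- by apply: (continuous_iota (f := f \+ g)) => x; apply: cvgD; [exact: cf|exact: cg].
- by apply: (continuous_iota (f := f \+ g)) => x; apply: cvgD; [exact: cf|exact: cg].
- by apply: (continuous_iota (f := f \- g)) => x; apply: cvgB; [exact: cf|exact: cg].
- by apply: (continuous_iota (f := f \- g)) => x; apply: cvgB; [exact: cf|exact: cg].
Qed.

Lemma continuous_tproj mu (f g : R -> E) : continuous f -> continuous g ->
  continuous (fun t => tproj iota mu (f t) (g t)).
Proof.
move=> cf cg t; apply: cvgB; first exact: cg.
apply: cvgZ; last exact: cf.
by apply: cvgM; [exact: continuous_hip|exact: cvg_cst].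
Qed.

Lemma continuous_to_sphere mu (f : R -> E) : (forall t, iota (f t) != 0) ->
  continuous f -> continuous (fun t => to_sphere iota mu (f t)).
Proof.
move=> f0 cf t; apply: cvgZ; last exact: cf.
apply: cvgM; first exact: cvg_cst.
apply: cvgV; first by rewrite normr_eq0.
by apply: cvg_norm; exact: continuous_iota.
Qed.

Lemma continuous_clamp_path (gamma : R -> E) :
  {within `[0 : R, 1], continuous gamma} -> continuous (gamma \o @clamp01 R).
Proof.
move=> /subspace_continuousP cg t.
have ct : `[0 : R, 1]%classic (clamp01 t) by rewrite /= in_itv/= clamp01_itv.
apply: cvg_trans (cg _ ct) => A /= wA.
have near_t := @continuous_clamp01 R t
  (fun y => `[0 : R, 1]%classic y -> A (gamma y)) wA.
apply: (@filterS _ (nbhs t) _ _ _ _ near_t) => x /= h; apply: h.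
by rewrite /= in_itv/= clamp01_itv.
Qed.

End PathContinuity.

Section Deformation.
Context {R : realType} {E H : hilbertType R}.
Variable iota : {linear E -> H}.
Hypothesis iota_le : forall u, `|iota u| <= `|u|.
Variable mu : R.
Hypothesis mu_gt0 : 0 < mu.
Variable phi : E -> R^o.
Hypothesis phi_C2 : unif_C2 phi.
Local Notation ell := (tdiff iota mu phi).
Local Notation hess := (thess iota mu phi).
Local Notation P := (tproj iota mu).
Local Notation retract := (to_sphere iota mu).

(** Both ends of the segment satisfy the descent conditions at [u] up to [om].  The
    factor [lam] is the cutoff: the model at [lam *: v] is
    [lam * (1 - lam) * s * l v + lam ^+ 2 * m v], whose first term is harmless and
    whose second is at most [- lam ^+ 2 * (k / 2)] up to multiples of [om], because
    [(1 - tau) ^+ 2 + tau ^+ 2 >= 1 / 2]. *)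
Lemma interpolated_descent (s k om lam tau : R) (u e0 e1 : E) :
  0 < s -> s <= 1 -> 0 <= k -> 0 <= om -> 0 <= lam <= 1 -> 0 <= tau <= 1 ->
  ell u e0 <= om -> ell u e1 <= om ->
  s * ell u e0 + s ^+ 2 / 2 * hess u e0 e0 <= - k + 2 * om ->
  s * ell u e1 + s ^+ 2 / 2 * hess u e1 e1 <= - k + 2 * om ->
  s * ell u e1 + s ^+ 2 / 2 * (hess u e0 e1 + hess u e1 e0) <= 2 * om ->
  forall e, e = (s * lam) *: ((1 - tau) *: e0 + tau *: e1) ->
  ell u e + hess u e e / 2 <= 4 * om - lam ^+ 2 * (k / 2).
Proof.
move=> s0 s1 k0 om0 /andP[l0 l1] /andP[t0 t1] T0 T1 m0 m1 N01 _ ->.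
rewrite !(tdiffZ, thessZl, thessZr, tdiffD, thessDl, thessDr).
move: T0 T1 m0 m1 N01.
move: (ell u e0) (ell u e1) (hess u e0 e0) (hess u e0 e1)
  (hess u e1 e0) (hess u e1 e1) => T0 T1 Q00 Q01 Q10 Q11 hT0 hT1 m0 m1 N01.
have hsT0 : s * T0 <= om.
  by rewrite (le_trans (ler_wpM2l (ltW s0) hT0))// ler_piMl.
have hsT1 : s * T1 <= om.
  by rewrite (le_trans (ler_wpM2l (ltW s0) hT1))// ler_piMl.
have t1' : 0 <= 1 - tau by rewrite subr_ge0.
have p0 : 0 <= tau * (1 - tau) by rewrite mulr_ge0.
have l1' : 0 <= 1 - lam by rewrite subr_ge0.
have q0 : 0 <= lam * (1 - lam) by rewrite mulr_ge0.
pose B := (1 - tau) ^+ 2 * (s * T0 + s ^+ 2 / 2 * Q00) +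
  tau ^+ 2 * (s * T1 + s ^+ 2 / 2 * Q11) +
  tau * (1 - tau) * (s * T0 + (s * T1 + s ^+ 2 / 2 * (Q01 + Q10))).
have hB : B <= - (k / 2) + 2 * om.
  have b1 := ler_wpM2l (sqr_ge0 (1 - tau)) m0.
  have b2 := ler_wpM2l (sqr_ge0 tau) m1.
  have b3 := ler_wpM2l p0 (lerD hsT0 N01).
  (* That is, [k * ((1 - tau) ^+ 2 + tau ^+ 2) >= k / 2]. *)
  have b4 : 0 <= k * (1 - 2 * tau) ^+ 2 by rewrite mulr_ge0// sqr_ge0.
  have b5 := mulr_ge0 p0 om0.
  rewrite /B; lra.
have hT : s * ((1 - tau) * T0 + tau * T1) <= om.
  have b1 := ler_wpM2l t1' hsT0; have b2 := ler_wpM2l t0 hsT1; lra.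
have c1 := ler_wpM2l q0 hT.
have c2 := ler_wpM2l (sqr_ge0 lam) hB.
have l2 : lam ^+ 2 <= 1 by rewrite expr_le1.
have c3 := ler_wpM2r om0 l2.
have c4 := mulr_ge0 (sqr_ge0 lam) om0.
have c5 := mulr_ge0 (sqr_ge0 (1 - lam)) om0.
have c6 := ler_wpM2r om0 l1.
have c7 := mulr_ge0 l0 om0.
move: c1 c2; rewrite /B; lra.
Qed.

Lemma descent_perturbation (s om k T Q T' Q' : R) : 0 < s -> s <= 1 ->
  0 <= om -> T' <= 0 -> s * T' + s ^+ 2 / 2 * Q' <= - k ->
  `|T - T'| <= om -> `|Q - Q'| <= om ->
  T <= om /\ s * T + s ^+ 2 / 2 * Q <= - k + 2 * om.
Proof.
move=> s0 s1 om0 T'0 m' /ler_normlP[_ dT'] /ler_normlP[_ dQ'].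
split; first lra.
have s2 : 0 <= s ^+ 2 by exact: sqr_ge0.
have b1 := ler_wpM2l (ltW s0) dT'; have b2 := ler_wpM2l s2 dQ'.
have b3 := ler_wpM2r om0 s1.
have s21 : s ^+ 2 <= 1 by rewrite expr_le1// ltW.
have b4 := ler_wpM2r om0 s21; lra.
Qed.

Lemma cross_perturbation (s om T Q P T' Q' P' : R) : 0 < s -> s <= 1 ->
  0 <= om -> s * T' + s ^+ 2 / 2 * (Q' + P') <= 0 ->
  `|T - T'| <= om -> `|Q - Q'| <= om -> `|P - P'| <= om ->
  s * T + s ^+ 2 / 2 * (Q + P) <= 2 * om.
Proof.
move=> s0 s1 om0 m' /ler_normlP[_ dT'] /ler_normlP[_ dQ'] /ler_normlP[_ dP'].
have s2 : 0 <= s ^+ 2 by exact: sqr_ge0.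
have b1 := ler_wpM2l (ltW s0) dT'; have b2 := ler_wpM2l s2 dQ'.
have b2' := ler_wpM2l s2 dP'; have b3 := ler_wpM2r om0 s1.
have s21 : s ^+ 2 <= 1 by rewrite expr_le1// ltW.
have b4 := ler_wpM2r om0 s21; lra.
Qed.

Lemma near_level (c d eps a b : R) : 0 < eps -> eps <= d / 4 ->
  c - eps < a -> a <= c + eps -> `|b - a| <= eps -> `|b - c| < d.
Proof.
move=> eps0 eps_d ca ac /ler_normlP[h1 h2].
by rewrite ltr_norml; apply/andP; split; lra.
Qed.

(** Above [c - eps / 2] the cutoff is 1 and the gain [k / 4 >= 2 * eps] beats the
    excess over [c]; below, there is still room for the error [eps / 4]. *)
Lemma cutoff_descent (c eps k a b : R) : 0 < eps -> eps <= k / 8 ->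
  a <= c + eps ->
  b <= a + eps / 4 - clamp01 ((a - (c - eps)) / (eps / 2)) ^+ 2 * (k / 4) ->
  b <= c - eps / 4.
Proof.
move=> eps0 epsk ac.
have [ha|ha] := leP (c - eps / 2) a.
  rewrite clamp01_ge1; last by rewrite ler_pdivlMr ?divr_gt0//; lra.
  by rewrite expr1n; lra.
have k0 : 0 <= k / 4 by lra.
by have := mulr_ge0 (sqr_ge0 (clamp01 ((a - (c - eps)) / (eps / 2)))) k0; lra.
Qed.

(** The new path moves [gamma t] by a tangential step and projects it back to the
    sphere.  The order of the choices matters: the step [s], hence the gain [k],
    depends only on [d] and on the ball, so [eps] can be small compared with [k];
    the tolerance [om] and the mesh are then chosen depending on [eps] and on the
    path, so the accumulated error is at most [eps / 4]. *)
Lemma path_below_level (w1 w2 : E) (c r d : R) : 0 < d ->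
  (forall u, sphere iota mu u -> `|u| <= r -> `|(phi u : R) - c| < d ->
    ~ (constrained_norm iota phi u <= d /\
       (approx_morse_index iota phi d u <= 1)%E)) ->
  exists2 eps0, 0 < eps0 & forall eps gamma, 0 < eps -> eps <= eps0 ->
    paths iota mu w1 w2 gamma ->
    (forall t, 0 <= t -> t <= 1 -> (phi (gamma t) : R) <= c + eps) ->
    (forall t, 0 <= t -> t <= 1 -> c - eps <= (phi (gamma t) : R) ->
       `|gamma t| <= r - 1) ->
    (phi w1 : R) <= c - eps -> (phi w2 : R) <= c - eps ->
    exists2 gamma', paths iota mu w1 w2 gamma' &
      forall t, 0 <= t -> t <= 1 -> (phi (gamma' t) : R) <= c - eps / 4.
Proof.
move=> d0 noncrit.
have [K K0 hK] := thess_bounded iota_le mu_gt0 phi_C2 r.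
pose C := 1 + r ^+ 2 / mu.
have C0 : 0 < C by rewrite ltr_pwDl// divr_ge0 ?sqr_ge0// ltW.
have sg0 : 0 < d / (8 * C ^+ 2) by rewrite divr_gt0// mulr_gt0// exprn_gt0.
have [dT dT0 hT] := taylor2_tangent iota_le mu_gt0 phi_C2 r sg0.
pose s := Num.min 1 (Num.min (d / K) (dT / C)).
have s0 : 0 < s by rewrite !lt_min ltr01 !divr_gt0.
have s1 : s <= 1 by rewrite ge_min lexx.
have sK : s * K <= d by rewrite -ler_pdivlMr// /s !ge_min lexx orbT.
have sC : C * s <= dT by rewrite mulrC -ler_pdivlMr// /s !ge_min lexx !orbT.
clearbody s.
pose k := s ^+ 2 * d / 2.
have k0 : 0 < k by rewrite divr_gt0// mulr_gt0// exprn_gt0.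
exists (Num.min (d / 4) (k / 8)).
  by rewrite lt_min (divr_gt0 d0)// (divr_gt0 k0).
move=> eps gamma eps0; rewrite le_min => /andP[eps_d eps_k].
move=> [cgamma sgamma gamma0 gamma1] le_eps high low1 low2.
pose om := eps / 16; have om0 : 0 < om by rewrite divr_gt0.
have [eta eta0 heta] := tforms_unif_cont iota_le mu_gt0 phi_C2 r om0.
pose g := gamma \o @clamp01 R.
have gE t : 0 <= t -> t <= 1 -> g t = gamma t.
  by move=> t0 t1; rewrite /g /= clamp01_id.
have sg t : sphere iota mu (g t).
  by apply: sgamma; rewrite in_itv/= clamp01_itv.
have cg : continuous g by exact: continuous_clamp_path.
have cphig : continuous (fun t => phi (g t) : R).
  have [phi_diff _ _ _] := phi_C2.
  move=> t; apply: (@continuous_comp _ _ _ g phi); first exact: cg.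
  exact: differentiable_continuous.
have eta1 : 0 < Num.min eta 1 by rewrite lt_min eta0 ltr01.
have [m1 m10 hm1] := @segment_unif_continuous _ _ _ 0 1 _ cg eta1.
have [m2 m20 hm2] := @segment_unif_continuous _ _ _ 0 1 _ cphig eps0.
have [N N0] : exists2 N : nat, (0 < N)%N & (N%:R^-1 : R) <= Num.min m1 m2.
  by apply: exists_invn_le; rewrite lt_min m10.
rewrite le_min => /andP[hN1 hN2].
(* The points near the critical level, where descent directions exist. *)
pose act u := sphere iota mu u /\ `|u| <= r /\ `|(phi u : R) - c| < d.
have selP u e : exists e', `|e'| <= 1 /\
    (act u -> `|e| <= 1 -> descends iota mu phi s k u e e').
  have [[[su [ur uc]] e1]|nact] := pselect (act u /\ `|e| <= 1); last first.
    by exists 0; rewrite normr0; split => // au e1; case: nact.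
  have [e' he'] := descent_direction d0 s0 s1 sK
    (fun e f e1 f1 => hK u e f ur e1 f1) su (noncrit u su ur uc) e1.
  by exists e'; split => //; case: he'.
(* The direction at a node depends on the direction at the previous node. *)
pose sel u e := sval (cid (selP u e)).
have sel1 u e : `|sel u e| <= 1 by have [] := svalP (cid (selP u e)).
have selD u e : act u -> `|e| <= 1 -> descends iota mu phi s k u e (sel u e).
  by have [_] := svalP (cid (selP u e)).
pose node i : R := i%:R / N%:R.
pose e i := nat_rect (fun=> E) (sel (g (node 0)) 0)
  (fun j ej => sel (g (node j.+1)) ej) i.
have e1 i : `|e i| <= 1 by case: i => [|i]; exact: sel1.
have eS i : e i.+1 = sel (g (node i.+1)) (e i) by [].
have e_self i : act (g (node i)) -> ell (g (node i)) (e i) <= 0 /\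
   s * ell (g (node i)) (e i) + s ^+ 2 / 2 * hess (g (node i)) (e i) (e i) <= - k.
  case: i => [|i] ai.
    have [|] := selD _ 0 ai; first by rewrite normr0.
    by split.
  by have [] := selD _ (e i) ai (e1 i).
have [p cp hp] := piecewise_linear N e.
(* The cutoff rises from 0 to 1 between the levels [c - eps] and [c - eps / 2]. *)
pose lam t := clamp01 (((phi (g t) : R) - (c - eps)) / (eps / 2)).
have clam : continuous lam.
  have -> : lam = @clamp01 R \o
    (fun t => ((phi (g t) : R) - (c - eps)) / (eps / 2)) by [].
  move=> t; apply: continuous_comp; last exact: continuous_clamp01.
  apply: cvgM; last exact: cvg_cst.
  by apply: cvgB; [exact: cphig|exact: cvg_cst].
pose x t := P (g t) ((s * lam t) *: p t).
have cx : continuous x.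
  apply: continuous_tproj => // t; apply: cvgZ; last exact: cp.
  by apply: cvgM; [exact: cvg_cst|exact: clam].
have gx t : hip iota (g t) (x t) = 0 by exact: tproj_tangent.
have gx0 t : iota (g t + x t) != 0.
  exact: (sphere_add_tangent_neq0 mu_gt0 (sg t) (gx t)).
pose gamma' t := retract (g t + x t).
have lam0 t : (phi (g t) : R) <= c - eps -> gamma' t = g t.
  move=> low; rewrite /gamma' /x /lam clamp01_le0; last first.
    by rewrite pmulr_lle0 ?invr_gt0 ?divr_gt0// subr_le0.
  by rewrite mulr0 tprojZ scale0r addr0 (to_sphere_id mu_gt0).
exists gamma'.
  split.
  - apply: continuous_subspaceT; apply: continuous_to_sphere => //.
    by move=> t; apply: cvgD; [exact: cg|exact: cx].
  - by move=> t _; exact: to_sphere_in.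
  - by rewrite lam0 gE// gamma0.
  - by rewrite lam0 gE// gamma1.
move=> t t0 t1.
have [low|hi] := leP (phi (g t) : R) (c - eps).
  rewrite lam0//; apply: le_trans low _.
  by rewrite lerD2l lerN2 ler_pdivrMr// ler_peMr ?(ltW eps0)// ler1n.
have [i [iN tau01 ti0 ti1]] := grid_index N0 t0 t1.
have near_act j : `|t - node j| <= N%:R^-1 ->
    act (g (node j)) /\ `|g t - g (node j)| <= eta.
  move=> tj; have := hm1 t (node j) t0 t1 (le_trans tj hN1).
  rewrite le_min => /andP[gj gj1].
  have := hm2 t (node j) t0 t1 (le_trans tj hN2) => phij.
  split => //; split; [exact: sg|split].
    rewrite -(subrK (g t) (g (node j))) -[leRHS](subrK 1) addrC.
    rewrite (le_trans (ler_normD _ _))// lerD//; last by rewrite distrC.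
    by rewrite gE//; apply: high => //; rewrite -gE// ltW.
  rewrite distrC in phij; apply: (near_level eps0 eps_d hi _ phij).
  by rewrite gE// le_eps.
have [act0 gt0] := near_act i ti0; have [act1 gt1] := near_act i.+1 ti1.
have gtr : `|g t| <= r.
  have : `|gamma t| <= r - 1 by apply: high => //; rewrite -gE// ltW.
  by rewrite gE// => /le_trans; apply; rewrite gerBl.
have [s00 s01] := e_self _ act0; have [s10 s11] := e_self _ act1.
have [_ _ _ scross] := selD _ (e i) act1 (e1 i); rewrite -eS in scross.
have U0 := heta (g t) (g (node i)) gtr act0.2.1 gt0.
have U1 := heta (g t) (g (node i.+1)) gtr act1.2.1 gt1.
have lam01 : 0 <= lam t <= 1 by exact: clamp01_itv.
pose tau := N%:R * t - i%:R.
have [T0 M0] := descent_perturbation s0 s1 (ltW om0) s00 s01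
  (U0 _ _ (e1 i) (e1 i)).1 (U0 _ _ (e1 i) (e1 i)).2.
have [T1 M1] := descent_perturbation s0 s1 (ltW om0) s10 s11
  (U1 _ _ (e1 i.+1) (e1 i.+1)).1 (U1 _ _ (e1 i.+1) (e1 i.+1)).2.
have M01 : s * ell (g t) (e i.+1) + s ^+ 2 / 2 *
    (hess (g t) (e i) (e i.+1) + hess (g t) (e i.+1) (e i)) <= 2 * om.
  exact: (cross_perturbation s0 s1 (ltW om0) scross
    (U1 _ _ (e1 i.+1) (e1 i)).1 (U1 _ _ (e1 i) (e1 i.+1)).2
    (U1 _ _ (e1 i.+1) (e1 i)).2).
have est := interpolated_descent s0 s1 (ltW k0) (ltW om0) lam01 tau01
  T0 T1 M0 M1 M01 (erefl _).
set z := (s * lam t) *: ((1 - tau) *: e i + tau *: e i.+1) in est.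
have px : x t = P (g t) z by rewrite /x (hp i).
have z_le : `|z| <= s * lam t.
  have sl0 : 0 <= s * lam t by rewrite mulr_ge0 ?(ltW s0)//; case/andP: lam01.
  by rewrite /z normrZ (ger0_norm sl0) ler_piMr//; exact: norm_interpolation_le1.
have x_le : `|x t| <= C * (s * lam t).
  rewrite px (le_trans (norm_tproj iota_le mu_gt0 z gtr))//.
  by rewrite ler_wpM2l// ltW.
have x_dT : `|x t| <= dT.
  rewrite (le_trans x_le)// (le_trans _ sC)// ler_wpM2l ?(ltW C0)//.
  by rewrite ler_piMr ?(ltW s0)//; case/andP: lam01.
have := hT (g t) (x t) (sg t) gtr (gx t) x_dT.
have -> : D2 iota phi (g t) (x t) (x t) = hess (g t) z z.
  by rewrite px /D2 /thess; move: (sg t); rewrite /sphere /= => ->.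
have -> : frechet phi (g t) (x t) = ell (g t) z by rewrite px.
rewrite -/(gamma' t).
have quad : d / (8 * C ^+ 2) * `|x t| ^+ 2 <= lam t ^+ 2 * (k / 4).
  have h : `|x t| ^+ 2 <= (C * (s * lam t)) ^+ 2.
    by rewrite lerXn2r ?nnegrE// (le_trans _ x_le).
  rewrite (le_trans (ler_wpM2l (ltW sg0) h))// le_eqVlt; apply/orP; left.
  by apply/eqP; rewrite /k; field; rewrite gt_eqF.
move=> phi_le; apply: (cutoff_descent eps0 eps_k (a := phi (g t))).
  by rewrite gE// le_eps.
rewrite -/(lam t); move: phi_le est quad.
move: (ell (g t) z) (hess (g t) z z) (lam t ^+ 2) (phi (g t) : R)
  (phi (gamma' t) : R) (d / (8 * C ^+ 2) * `|x t| ^+ 2).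
rewrite /om; clear; move: eps k => eps k T Q l a b q; lra.
Qed.

End Deformation.

(** * The minimax level and the monotonicity trick *)

Section Minimax.
Context {R : realType} {E H : hilbertType R}.
Variable iota : {linear E -> H}.
Variable mu : R.
Variables w1 w2 : E.
Local Notation paths := (paths iota mu w1 w2).

Lemma path_has_ubound (phi : E -> R) (gamma : R -> E) : continuous phi ->
  {within `[0 : R, 1], continuous gamma} ->
  has_ubound [set phi (gamma t) | t in `[0 : R, 1]].
Proof.
move=> cphi cgamma.
have cpg : continuous (fun t : R => phi (gamma (clamp01 t))).
  move=> t; apply: (@continuous_comp _ _ _ (gamma \o @clamp01 R) phi).
    exact: continuous_clamp_path.
  exact: cphi.
have [x _ hx] := EVT_max (@ler01 R) (continuous_subspaceT cpg).
exists (phi (gamma (clamp01 x))) => _ [t t01 <-].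
have := hx t t01; move: t01; rewrite /= in_itv/= => /andP[t0 t1].
by rewrite clamp01_id.
Qed.

Lemma path_sup_ge (phi : E -> R) gamma t : continuous phi -> paths gamma ->
  0 <= t -> t <= 1 -> phi (gamma t) <= sup [set phi (gamma t) | t in `[0 : R, 1]].
Proof.
move=> cphi [cg _ _ _] t0 t1; apply: ub_le_sup; first exact: path_has_ubound.
by exists t => //; rewrite /= in_itv/= t0.
Qed.

Lemma minimax_has_lbound (phi : E -> R) : continuous phi ->
  has_lbound [set sup [set phi (gamma t) | t in `[0 : R, 1]] | gamma in paths].
Proof.
move=> cphi; exists (phi w1) => _ [gamma pg <-].
have [_ _ g0 _] := pg; rewrite -g0.
by apply: path_sup_ge.
Qed.

Lemma minimax_le (phi : E -> R) gamma M : continuous phi -> paths gamma ->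
  (forall t, 0 <= t -> t <= 1 -> phi (gamma t) <= M) ->
  minimax iota phi mu w1 w2 <= M.
Proof.
move=> cphi pg gM.
apply: (@le_trans _ _ (sup [set phi (gamma t) | t in `[0 : R, 1]])).
  by apply: ge_inf; [exact: minimax_has_lbound|exists gamma].
apply: ge_sup.
  by exists (phi (gamma 0)), 0 => //; rewrite /= in_itv/= lexx ler01.
by move=> _ [t + <-]; rewrite /= in_itv/= => /andP[t0 t1]; exact: gM.
Qed.

Lemma minimax_approx (phi : E -> R) eps : continuous phi -> paths !=set0 ->
  0 < eps -> exists2 gamma, paths gamma &
    forall t, 0 <= t -> t <= 1 -> phi (gamma t) <= minimax iota phi mu w1 w2 + eps.
Proof.
move=> cphi [g0 pg0] eps0.
have hi : has_inf [set sup [set phi (gamma t) | t in `[0 : R, 1]] | gamma in paths].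
  split; last exact: minimax_has_lbound.
  by exists (sup [set phi (g0 t) | t in `[0 : R, 1]]), g0.
have [_ [gamma pg <-] lt] := inf_adherent eps0 hi.
exists gamma => // t t0 t1; apply: le_trans (ltW lt).
exact: path_sup_ge.
Qed.

Lemma le_minimax (phi psi : E -> R) : continuous phi -> continuous psi ->
  paths !=set0 -> (forall u, phi u <= psi u) ->
  minimax iota phi mu w1 w2 <= minimax iota psi mu w1 w2.
Proof.
move=> cphi cpsi ps le; apply/ler_addgt0Pr => e e0.
have [gamma pg hg] := minimax_approx cpsi ps e0.
apply: (minimax_le cphi pg) => t t0 t1.
exact: le_trans (hg t t0 t1).
Qed.

Hypothesis iota_le : forall u, `|iota u| <= `|u|.
Hypothesis iota_inj : injective iota.
Hypothesis mu_gt0 : 0 < mu.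

Lemma segment_neq0 (v w : E) (a b : R) : (forall c, w != c *: v) ->
  v != 0 -> a + b != 0 -> a *: v + b *: w != 0.
Proof.
move=> wv v0 ab; have [b0|b0] := eqVneq b 0.
  rewrite b0 scale0r addr0 scaler_eq0 negb_or v0 andbT.
  by move: ab; rewrite b0 addr0.
apply/eqP => /eqP; rewrite addr_eq0 => /eqP ew.
have /eqP := wv (- (b^-1 * a)); apply.
by rewrite scaleNr -scalerA ew scalerN opprK scalerA mulVf// scale1r.
Qed.

(** Two segments through a vector [v] that is on neither of the lines of [w1] and
    [w2] avoid the origin, so they project to the sphere.  The detour by [v] covers
    the case of antipodal end points. *)
Lemma paths_nonempty : infinite_dim E -> sphere iota mu w1 ->
  sphere iota mu w2 -> paths !=set0.
Proof.
move=> E_inf s1 s2.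
have nz w : sphere iota mu w -> w != 0.
  move=> sw; apply: contraTneq mu_gt0 => w0; move: sw.
  by rewrite /sphere /= w0 linear0 normr0 expr0n/= => <-; rewrite ltxx.
have w10 := nz _ s1; have w20 := nz _ s2.
have [x [y [_ _ xy]]] : exists x y, [/\ [set: E] x, [set: E] y &
    independent_pair (R := R) x y].
  by apply: edim_gt1; rewrite E_inf ltry.
have [v v1 v2] : exists2 v : E, (forall c, v != c *: w1) & (forall c, v != c *: w2).
  have [[c w2E]|nw] := pselect (exists c, w2 = c *: w1); last first.
    exists (w1 + w2) => c; apply/eqP => h.
      apply: nw; exists (c - 1); rewrite scalerBl scale1r -h.
      by rewrite addrC addKr.
    have c1 : c != 1.
      apply: contraNneq w10 => c1; move: h; rewrite c1 scale1r => /eqP.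
      by rewrite -subr_eq0 addrK.
    apply: nw; exists (c - 1)^-1.
    have : w1 = (c - 1) *: w2 by rewrite scalerBl scale1r -h addrK.
    by move=> ->; rewrite scalerA mulVf ?scale1r// subr_eq0.
  suff [v hv] : exists v : E, forall c, v != c *: w1.
    by exists v => // b; rewrite w2E scalerA; exact: hv.
  apply: contrapT => /forallNP h.
  have [a xE] : exists a, x = a *: w1.
    by have /existsNP[a /negP/negPn/eqP ->] := h x; exists a.
  have [b yE] : exists b, y = b *: w1.
    by have /existsNP[b /negP/negPn/eqP ->] := h y; exists b.
  have [] := xy b (- a).
    by rewrite xE yE !scalerA mulNr mulrC -scalerDl subrr scale0r.
  move=> b0 /eqP; rewrite oppr_eq0 => /eqP a0.
  have [] := xy 1 0; first by rewrite xE a0 !scale0r scaler0 addr0.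
  by move/eqP; rewrite oner_eq0.
have [p cp hp] := piecewise_linear 2 (nth 0 [:: w1; v; w2]).
have p0 t : 0 <= t -> t <= 1 -> p t != 0.
  move=> t0 t1; have [i [i2 i01 _ _]] := grid_index (isT : (0 < 2)%N) t0 t1.
  rewrite (hp i)//; case: i i2 i01 => [|[|//]] _ _ /=.
    by apply: segment_neq0 => //; rewrite subrK oner_eq0.
  by rewrite addrC; apply: segment_neq0 => //; rewrite addrC subrK oner_eq0.
have p_at0 : p 0 = w1.
  have -> := hp 0 0 isT; rewrite mulr0 subr0 ?lexx ?ler01//=.
  by rewrite subr0 scale1r scale0r addr0.
have p_at1 : p 1 = w2.
  have E21 : 2 * 1 - 1 = 1 :> R by ring.
  have -> := hp 1 1 isT; rewrite E21 ?lexx ?ler01//=.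
  by rewrite subrr scale0r add0r scale1r.
have ip0 t : iota (p (clamp01 t)) != 0.
  have /andP[c0 c1] := clamp01_itv t.
  apply/eqP => h; have /eqP := p0 _ c0 c1; apply.
  by apply: iota_inj; rewrite h linear0.
exists (fun t => to_sphere iota mu (p (clamp01 t))); split.
- apply: continuous_subspaceT; apply: (continuous_to_sphere iota_le) => //.
  move=> t; apply: (@continuous_comp _ _ _ (@clamp01 R) p).
    exact: continuous_clamp01.
  exact: cp.
- by move=> t _; exact: to_sphere_in.
- by rewrite clamp01_id// p_at0 (to_sphere_id mu_gt0).
- by rewrite clamp01_id// p_at1 (to_sphere_id mu_gt0).
Qed.

End Minimax.

Section MonotonicityTrick.
Context {R : realType} {E H : hilbertType R}.
Variable iota : {linear E -> H}.
Variable mu : R.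
Variables w1 w2 : E.
Local Notation paths := (paths iota mu w1 w2).
Variables (I : set R) (Phi : R -> E -> R) (A B : E -> R).
Hypothesis paths0 : paths !=set0.
Hypothesis PhiE : forall rho, I rho -> forall u, Phi rho u = A u - rho * B u.
Hypothesis B_ge0 : forall u, 0 <= B u.
Hypothesis Phi_cont : forall rho, I rho -> continuous (Phi rho).
Local Notation c rho := (minimax iota (Phi rho) mu w1 w2).

Lemma Phi_nonincreasing rho sigma u : I rho -> I sigma -> rho <= sigma ->
  Phi sigma u <= Phi rho u.
Proof.
by move=> Ir Is rs; rewrite !PhiE// lerD2l lerN2 ler_wpM2r.
Qed.

Lemma minimax_nonincreasing rho sigma : I rho -> I sigma -> rho <= sigma ->
  c sigma <= c rho.
Proof.
move=> Ir Is rs; apply: le_minimax => //; [exact: Phi_cont|exact: Phi_cont|].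
by move=> u; exact: Phi_nonincreasing.
Qed.

(** The path is almost optimal for a parameter [y < rho] with
    [c y - c rho <= M * (rho - y)], up to [rho - y].  Since [Phi rho <= Phi y], it
    stays below [c rho + eps] with [eps] proportional to [rho - y].  Where
    [Phi rho] exceeds [c rho - eps], the identity
    [Phi y - Phi rho = (rho - y) * B] bounds [B], and then [A]. *)
Lemma bounded_almost_optimal_paths rho : I rho -> 0 < rho ->
  norm_coercive A \/ norm_coercive B ->
  left_slope_bounded I (fun sigma => c sigma) rho ->
  exists r : R, forall eps0, 0 < eps0 -> exists eps gamma,
    [/\ 0 < eps, eps <= eps0, paths gamma,
        forall t, 0 <= t -> t <= 1 -> Phi rho (gamma t) <= c rho + eps &
        forall t, 0 <= t -> t <= 1 -> c rho - eps <= Phi rho (gamma t) ->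
          `|gamma t| <= r].
Proof.
move=> Ir rho0 AB [M0 slope].
(* The added 1 accounts for the error [rho - y] of the almost optimal path. *)
pose M := Num.max M0 0 + 1.
have M_gt0 : 0 < M by rewrite ltr_wpDl// le_max lexx orbT.
have [r hr] : exists r : R, forall u, B u <= 2 * M ->
    A u <= c rho + M + rho * (2 * M) -> `|u| <= r.
  case: AB => coer.
    have [r hr] := coer (c rho + M + rho * (2 * M) + 1).
    exists r => u _ Au; rewrite leNgt; apply/negP => /ltW/hr; lra.
  have [r hr] := coer (2 * M + 1).
  exists r => u Bu _; rewrite leNgt; apply/negP => /ltW/hr; lra.
exists r => eps0 eps00.
have eta0 : 0 < Num.min 1 (eps0 / M) by rewrite lt_min ltr01 divr_gt0.
have [y [Iy ylt yrho cy]] := slope _ eta0.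
have h0 : 0 < rho - y by rewrite subr_gt0.
have [h1 h2] : rho - y <= 1 /\ rho - y <= eps0 / M.
  have : rho - y <= Num.min 1 (eps0 / M) by lra.
  by rewrite le_min => /andP[].
have [gamma pg hg] := minimax_approx (Phi_cont Iy) paths0 h0.
have cyM : c y + (rho - y) <= c rho + M * (rho - y).
  have : M0 * (rho - y) <= Num.max M0 0 * (rho - y).
    by rewrite ler_wpM2r ?(ltW h0)// le_max lexx.
  rewrite /M; move: cy; lra.
have gle t : 0 <= t -> t <= 1 -> Phi y (gamma t) <= c rho + M * (rho - y).
  by move=> t0 t1; apply: le_trans cyM; exact: hg.
exists (M * (rho - y)), gamma; split => //.
- exact: mulr_gt0.
- by rewrite mulrC -ler_pdivlMr.
- move=> t t0 t1; apply: le_trans (gle t t0 t1).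
  by apply: Phi_nonincreasing => //; exact: ltW.
move=> t t0 t1 hi; have lo := gle t t0 t1.
have Bg := B_ge0 (gamma t).
have eE : Phi y (gamma t) - Phi rho (gamma t) = (rho - y) * B (gamma t).
  by rewrite !PhiE//; ring.
have B2M : B (gamma t) <= 2 * M.
  by rewrite -(ler_pM2l h0) -eE; lra.
apply: hr => //.
have AE : A (gamma t) = Phi rho (gamma t) + rho * B (gamma t).
  by rewrite PhiE//; ring.
have b1 := ler_wpM2l (ltW rho0) B2M.
have b2 : Phi rho (gamma t) <= Phi y (gamma t).
  by apply: Phi_nonincreasing => //; exact: ltW.
have b3 : M * (rho - y) <= M by rewrite ler_piMr// ltW.
by rewrite AE; lra.
Qed.

End MonotonicityTrick.

(** * Approximate critical points of low index *)

Section ApproximateCriticalPoints.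
Context {R : realType} {E H : hilbertType R}.
Variable iota : {linear E -> H}.
Hypothesis iota_le : forall u, `|iota u| <= `|u|.
Variable mu : R.
Hypothesis mu_gt0 : 0 < mu.
Variables w1 w2 : E.
Local Notation paths := (paths iota mu w1 w2).
Variable phi : E -> R.
Hypothesis phi_C2 : unif_C2 (phi : E -> R^o).
Local Notation c := (minimax iota phi mu w1 w2).

Lemma unif_C2_continuous : continuous phi.
Proof.
by move=> u; apply: differentiable_continuous; have [] := phi_C2.
Qed.

(** Otherwise [path_below_level] would turn an almost optimal path into one below
    the minimax level.  The ball grows by 1 because the nodes of the subdivision
    near a high point of the path need not be high themselves. *)
Lemma approximate_critical_point (r : R) :
  Num.max (phi w1) (phi w2) < c ->
  (forall eps0, 0 < eps0 -> exists eps gamma,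
    [/\ 0 < eps, eps <= eps0, paths gamma,
        forall t, 0 <= t -> t <= 1 -> phi (gamma t) <= c + eps &
        forall t, 0 <= t -> t <= 1 -> c - eps <= phi (gamma t) ->
          `|gamma t| <= r]) ->
  forall d, 0 < d -> exists u,
    [/\ sphere iota mu u, `|u| <= r + 1, `|phi u - c| < d,
        constrained_norm iota phi u <= d &
        (approx_morse_index iota phi d u <= 1)%E].
Proof.
rewrite gt_max => /andP[c1 c2] opt d d0; apply: contrapT => ncrit.
have [|eps0 eps00 deform] := @path_below_level _ _ _ _ iota_le _ mu_gt0 _ phi_C2
    w1 w2 c (r + 1) _ d0.
  by move=> u su ur uc [h1 h2]; apply: ncrit; exists u.
have e0 : 0 < Num.min eps0 (Num.min (c - phi w1) (c - phi w2)).
  by rewrite !lt_min eps00 !subr_gt0 c1.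
have [eps [gamma [eps_gt0 + pg gc ghigh]]] := opt _ e0.
rewrite !le_min => /and3P[ee0 e1 e2].
have [| | |gamma' pg' low] := deform eps gamma eps_gt0 ee0 pg gc.
- by rewrite addrK.
- by rewrite lerBrDr -lerBrDl.
- by rewrite lerBrDr -lerBrDl.
have := minimax_le unif_C2_continuous pg' low; lra.
Qed.

Lemma approximate_critical_sequence (r : R) :
  (forall d, 0 < d -> exists u,
    [/\ sphere iota mu u, `|u| <= r, `|phi u - c| < d,
        constrained_norm iota phi u <= d &
        (approx_morse_index iota phi d u <= 1)%E]) ->
  exists (u : nat -> E) (zeta : nat -> R),
      [/\ forall n, sphere iota mu (u n),
          forall n, 0 < zeta n
        & zeta n @[n --> \oo] --> (0 : R)] /\
      [/\ phi (u n) @[n --> \oo] --> c,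
          constrained_norm iota phi (u n) @[n --> \oo] --> (0 : R),
          bounded_set (range u)
        & forall n,
            (approx_morse_index iota phi (zeta n) (u n) <= 1)%E].
Proof.
move=> crit.
have zeta0 n : 0 < (harmonic n : R) by rewrite invr_gt0 ltr0n.
have /choice[u hu] : forall n, exists u,
    [/\ sphere iota mu u, `|u| <= r, `|phi u - c| < harmonic n,
        constrained_norm iota phi u <= harmonic n &
        (approx_morse_index iota phi (harmonic n) u <= 1)%E].
  by move=> n; exact: crit.
have hc : (@harmonic R) n @[n --> \oo] --> (0 : R) by exact: cvg_harmonic.
exists u, harmonic; split; split => //.
- by move=> n; have [] := hu n.
- apply/cvgrPdist_le => e e0.
  move/cvgrPdist_le : hc => /(_ _ e0); apply: filterS => n.
  rewrite sub0r normrN gtr0_norm// distrC => /(le_trans _); apply.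
  by have [_ _ /ltW] := hu n.
- apply: (squeeze_cvgr _ (cvg_cst 0) hc); apply: nearW => n.
  have [_ _ _ -> _] := hu n; rewrite andbT; apply: norm_on_ge0.
  by rewrite /tangent /= !linear0.
- exists r; split; first exact: num_real.
  by move=> x rx _ [n _ <-]; have [_ ur _ _ _] := hu n; exact: le_trans ur (ltW rx).
- by move=> n; have [] := hu n.
Qed.

End ApproximateCriticalPoints.

Theorem theorem1p5 (R : realType) (E H : hilbertType R)
    (E_infinite : infinite_dim E) (H_infinite : infinite_dim H)
    (iota : {linear E -> H}) (rigging : hilbert_rigging iota)
    (mu : R) (mu_gt0 : 0 < mu)
    (I : set R) (I_interval : is_interval I) (I_gt0 : forall rho, I rho -> 0 < rho)
    (Phi : R -> E -> R) (A B : E -> R)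
    (PhiE : forall rho, I rho -> forall u, Phi rho u = A u - rho * B u)
    (Phi_C2 : forall rho, I rho -> C2 (Phi rho : E -> R^o))
    (B_ge0 : forall u, 0 <= B u)
    (A_or_B_coercive : norm_coercive A \/ norm_coercive B)
    (alpha : R) (alpha_gt0 : 0 < alpha) (alpha_le1 : alpha <= 1)
    (Phi'_holder : forall rho, I rho ->
       holder_on_bounded alpha (frechet (Phi rho : E -> R^o)))
    (Phi''_holder : forall rho, I rho ->
       holder_on_bounded alpha (frechet (frechet (Phi rho : E -> R^o))))
    (w1 w2 : E) (w1_sphere : sphere iota mu w1) (w2_sphere : sphere iota mu w2)
    (mountain_pass : forall rho, I rho ->
       Num.max (Phi rho w1) (Phi rho w2) < minimax iota (Phi rho) mu w1 w2) :
  {ae (@lebesgue_measure R), forall rho, I rho ->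
    exists (u : nat -> E) (zeta : nat -> R),
      [/\ forall n, sphere iota mu (u n),
          forall n, 0 < zeta n
        & zeta n @[n --> \oo] --> (0 : R)] /\
      [/\ Phi rho (u n) @[n --> \oo] --> minimax iota (Phi rho) mu w1 w2,
          constrained_norm iota (Phi rho) (u n) @[n --> \oo] --> (0 : R),
          bounded_set (range u)
        & forall n,
            (approx_morse_index iota (Phi rho) (zeta n) (u n) <= 1)%E]}.
Proof.
have [iota_inj iota_le _] := rigging.
have paths0 := paths_nonempty iota_le iota_inj mu_gt0 E_infinite
  w1_sphere w2_sphere.
have Phi_unif rho : I rho -> unif_C2 (Phi rho : E -> R^o).
  move=> Ir; have [d1 d2 _] := Phi_C2 _ Ir; split => //.
    split; first exact: holder_unif_cont (Phi'_holder _ Ir).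
    exact: holder_bounded (Phi'_holder _ Ir).
  split; first exact: holder_unif_cont (Phi''_holder _ Ir).
  exact: holder_bounded (Phi''_holder _ Ir).
have Phi_cont rho (Ir : I rho) := unif_C2_continuous (Phi_unif _ Ir).
have slopes := @ae_left_slope_bounded R I
  (fun rho => minimax iota (Phi rho) mu w1 w2) I_interval
  (fun rho sigma Ir Is => minimax_nonincreasing paths0 PhiE B_ge0 Phi_cont Ir Is).
apply: negligibleS slopes => rho; apply: contra_not => slope Ir.
have [r hr] := bounded_almost_optimal_paths paths0 PhiE B_ge0 Phi_cont Ir
  (I_gt0 _ Ir) A_or_B_coercive (slope Ir).
apply: (@approximate_critical_sequence _ _ _ _ _ _ _ _ (r + 1)).
exact: (approximate_critical_point iota_le mu_gt0 (Phi_unif _ Ir)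
  (mountain_pass _ Ir)).
Qed.
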